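(* Let $v$ be a polynomial vector field on $\mathbb{C}^2$, let $\mathcal{F}_v$ be the foliation it defines on $\mathbb{P}^2$, and suppose that the line at infinity $L=\mathbb{P}^2\setminus\mathbb{C}^2$ is invariant for $\mathcal{F}_v$. If the singularities of $\mathcal{F}_v$ along $L$ are non-degenerate, then $$\sum_{p\in L\cap\operatorname{Sing}\mathcal{F}_v}\operatorname{CS}(\mathcal{F}_v,L,p)=1 .$$
   Context: A polynomial vector field $v$ on $\mathbb{C}^2$ induces a singular holomorphic foliation $\mathcal{F}_v$ with isolated singularities on $\mathbb{P}^2\supset\mathbb{C}^2$, namely the extension to $\mathbb{P}^2$ of the foliation of $\mathbb{C}^2$ tangent to $v$. Locally around each point of $\mathbb{P}^2$, $\mathcal{F}_v$ is generated by a holomorphic vector field $w$ with isolated zeros, unique up to multiplication by a nowhere vanishing holomorphic function; $\operatorname{Sing}\mathcal{F}_v$ is the set of points where $w$ vanishes, and a singular point $p$ is non-degenerate if the linearization $Dw(p)$ is invertible. The line $L$ is invariant if $w$ is tangent to $L$ at each point of $L$ (in this case $v$ is called non-dicritic). Camacho-Sad index: if $p\in L\cap \operatorname{Sing}\mathcal{F}_v$, choose local coordinates $(s,t)$ centered at $p$ with $L=\{t=0\}$, so that $\mathcal{F}_v$ is generated by $w=a(s,t)\frac{\partial}{\partial s}+t\,b(s,t)\frac{\partial}{\partial t}$; then $\operatorname{CS}(\mathcal{F}_v,L,p)=\operatorname{Res}_{s=0}\frac{b(s,0)}{a(s,0)}\,ds$. When $p$ is non-degenerate this equals $b(0,0)/\frac{\partial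 a}{\partial s}(0,0)$, the quotient of the eigenvalue of $Dw(p)$ on the normal direction $T_p\mathbb{P}^2/T_pL$ by the eigenvalue on $T_pL$. *)

(* Defs.v *)
From HB Require Import structures.
From mathcomp Require Import all_boot all_order all_algebra.
From mathcomp Require Import all_classical all_reals all_analysis.
From mathcomp Require Import complex.

Set Implicit Arguments.
Unset Strict Implicit.
Unset Printing Implicit Defensive.

Import Order.TTheory GRing.Theory Num.Theory.
Import numFieldNormedType.Exports.

Local Open Scope classical_set_scope.
Local Open Scope ring_scope.

(* Naming the structure makes the analysis instances (topology, norm over
   itself) attached to any numClosedFieldType available on R[i]. *)
Definition CC (R : realType) : numClosedFieldType := R[i].

Section Foliation.

Variable R : realType.
Notation C := (CC R).

(* A point of P^2 is a line through the origin of C^3. *)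
Definition P2 : Type := {U : {vspace 'rV[C]_3} | \dim U == 1%N}.

(* Homogeneous coordinates of the point q of the k-th standard affine chart:
   [1 : q.1 : q.2], [q.1 : 1 : q.2] and [q.1 : q.2 : 1] for k = 0, 1, 2. *)
Definition homog (k : 'I_3) (q : C * C) : 'rV[C]_3 :=
  \row_j (if unlift k j is Some i then (if i == ord0 then q.1 else q.2) else 1).

Lemma dim_homog (k : 'I_3) (q : C * C) : \dim <[homog k q]>%VS == 1%N.
Proof.
rewrite dim_vline; case: (homog k q =P 0) => // h0.
have := congr1 (fun X : 'rV[C]_3 => X ord0 k) h0.
by rewrite !mxE unlift_none => /eqP; rewrite oner_eq0.
Qed.

Definition pt (k : 'I_3) (q : C * C) : P2 :=
  exist _ <[homog k q]>%VS (dim_homog k q).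

(* C^2 is the chart k = 2, so that the line at infinity is the zero locus of
   the last homogeneous coordinate. *)
Definition Linf : set P2 :=
  [set p : P2 | forall X : 'rV[C]_3,
    X \in (sval p : {vspace 'rV[C]_3}) -> X ord0 ord_max = 0].

Definition affine_coord (X : 'rV[C]_3) : C * C :=
  (X ord0 ord0 / X ord0 ord_max, X ord0 (inord 1) / X ord0 ord_max).

(* v = (P, Q) stands for P d/dx + Q d/dy; in {poly {poly C}}
   the outer indeterminate is x and the inner one is y, as in polyXY. *)
Definition polyvf : Type := ({poly {poly C}} * {poly {poly C}})%type.

Definition vf (v : polyvf) (q : C * C) : C * C :=
  (v.1.[q.1, q.2], v.2.[q.1, q.2]).

Definition isolated_zeros (f : C * C -> C * C) : Prop :=
  forall q, f q = 0 -> \forall q' \near q, f q' = 0 -> q' = q.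

(* In each affine chart the foliation F_v is generated by a polynomial vector
   field w with isolated zeros, unique up to a nonzero constant: the one whose
   image under the change of coordinates affine_coord \o homog k to C^2 is
   collinear with v at every point of the chart lying in C^2. *)
Definition generates (v : polyvf) (k : 'I_3) (w : polyvf) : Prop :=
  isolated_zeros (vf w) /\
  forall q : C * C, homog k q ord0 ord_max != 0 ->
    let dw : C * C := 'd (affine_coord \o homog k) q (vf w q) in
    let vq := vf v (affine_coord (homog k q)) in
    dw.1 * vq.2 = dw.2 * vq.1.

Definition generates_at (v : polyvf) (p : P2) k (q : C * C) (w : polyvf) : Prop :=
  pt k q = p /\ generates v k w.

Definition Sing (v : polyvf) : set P2 :=
  [set p | exists k q w, generates_at v p k q w /\ vf w q = 0].

Definition nondegenerate_at (v : polyvf) (p : P2) : Prop :=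
  exists k q w, [/\ generates_at v p k q w, vf w q = 0
                  & bijective ('d (vf w) q : C * C -> C * C)].

(* homog k q ord0 ord_max is the local expression of the last homogeneous
   coordinate, hence a local equation of the line at infinity. *)
Definition Linf_invariant (v : polyvf) : Prop :=
  forall p, Linf p -> exists k q w, generates_at v p k q w /\
    'd (fun q' : C * C => homog k q' ord0 ord_max : C) q (vf w q) = 0.

(* c is the coefficient of 1/s in a Laurent expansion at 0 with finite
   principal part. *)
Definition is_residue0 (f : C -> C) (c : C) : Prop :=
  exists (n : nat) (l : nat -> C) (h : C -> C),
    [/\ \forall s \near (0 : C), differentiable h s,
        \forall s \near (0 : C), s != 0 ->
          f s = (\sum_(k < n.+1) l k / s ^+ k.+1) + h s
      & l 0%N = c].

(* (s, t) are the affine coordinates of the chart k centered at p. *)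
Definition is_CS (v : polyvf) (p : P2) (c : C) : Prop :=
  exists k q w (a b : {poly {poly C}}),
    [/\ generates_at v p k q w,
        forall s t : C, Linf (pt k (q + (s, t))) <-> t = 0,
        forall s t : C, vf w (q + (s, t)) = (a.[s, t], t * b.[s, t])
      & is_residue0 (fun s => b.[s, 0] / a.[s, 0]) c].

Definition CS (v : polyvf) (p : P2) : C := xget 0 (is_CS v p).

End Foliation.

(* Main.v *)
Require Import Defs.
From HB Require Import structures.
From mathcomp Require Import all_boot all_order all_algebra.
From mathcomp Require Import all_classical all_reals all_analysis.
From mathcomp Require Import ring zify.

Import Order.TTheory.
Import GRing.Theory Num.Theory.
Import numFieldNormedType.Exports.
Local Open Scope classical_set_scope.
Local Open Scope ring_scope.

(** The line at infinity meets the two charts [1 : u : t] and [s : 1 : r], in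
    both of which it is the first axis, and these charts overlap through
    [(u, t) = (s^-1, r / s)]. Invariance provides generators [w0] and [w1] of
    the foliation in them, of the form
    [w0 = A0 d/du + t b0 d/dt] and [w1 = A1 d/ds + r b1 d/dr].
    Since the zeros of a generator are isolated, its two components have no
    common factor, so two generators of the same chart are proportional
    ([generates_proportional]), and on the overlap [w1] is the image of [w0]
    times a factor which restricts to a constant times a power of [s] on the
    line ([rel_charts_monomial]). Restricted to the line this reads, with
    [a0 = A0(u, 0)], [a1 = A1(s, 0)] and up to powers of [s],

      [- s ^ 2 * a0 (1 / s) = c * a1 (s)] and
      [b0 (1 / s) - s * a0 (1 / s) = c * b1 (s)],

    that is to say [b1 / a1 ds = b0 / a0 du + ds / s]. The indices are the
    residues of these two meromorphic forms at the zeros of [a0] and, for the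
    point [s = 0], at the zero of [a1]. The residues of [b0 / a0 du] on the
    projective line add up to 0, and the additional term [ds / s] contributes
    the 1 of the conclusion. As the zeros are simple, this residue theorem is
    the case of Lagrange interpolation given in [sum_residues_P1].

    The algebra rests on two facts. Isolated zeros imply the absence of common
    factors ([isolated_zeros_coprime2]), because a common factor vanishes along
    a curve, whose points are accumulated by others: this is the continuity of
    the roots of a polynomial in its coefficients ([nearby_zero]). Collinearity
    with [v], known only where [v] does not vanish, extends to an identity
    between polynomials by density ([density]).

    Finally, all the notions attached to a point of the line (being singular,
    being non-degenerate, the index) quantify over the charts and generators
    around it. [local_model] records that all these choices give the same zeros
    and the same ratio of eigenvalues, which makes the index computable from
    one generator ([CS_local_model]). *)

Set Implicit Arguments.
Unset Strict Implicit.

(* Evaluation rules that keep the shape of the expression. *)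
Local Notation hrE := (horner0, hornerM, hornerD, hornerN, hornerX, hornerXn, hornerC, hornerZ, horner_exp).

(* The two affine charts that meet the line at infinity, and the chart
   [C ^ 2]. *)
Local Notation k0 := (ord0 : 'I_3).
Local Notation k1 := (inord 1 : 'I_3).
Local Notation k2 := (ord_max : 'I_3).

(** * Polynomials in one variable and the residue theorem *)

Section UnivariatePolynomials.

Variable F : numClosedFieldType.
Implicit Types (p q : {poly F}) (x : F).

Lemma poly_fun0 p : (forall x, p.[x] = 0) -> p = 0.
Proof.
move=> p0; apply/eqP; apply/negPn/negP => pN0.
suff : (size [seq (i%:R : F) | i <- iota 0 (size p)] < size p)%N.
  by rewrite size_map size_iota ltnn.
apply: (max_poly_roots pN0 _ _); first by apply/allP => x _; apply/rootP.
rewrite map_inj_uniq ?iota_uniq// => i j /eqP.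
by rewrite eqr_nat => /eqP.
Qed.

Lemma eq_poly_off (s : seq F) p q :
  (forall x, x \notin s -> p.[x] = q.[x]) -> p = q.
Proof.
move=> pq; apply/eqP; rewrite -subr_eq0.
have : (p - q) * \prod_(z <- s) ('X - z%:P) = 0.
  apply: poly_fun0 => x; rewrite hornerM.
  have [xs|xs] := boolP (x \in s).
    have /rootP -> : root (\prod_(z <- s) ('X - z%:P)) x by rewrite root_prod_XsubC.
    by rewrite mulr0.
  by rewrite hornerD hornerN pq// subrr mul0r.
move/eqP; rewrite mulf_eq0 => /orP[//|].
by rewrite prodf_seq_eq0 => /hasP[z _]; rewrite /= polyXsubC_eq0.
Qed.

(** Comparison of Laurent coefficients: [x ^+ n * p.[x^-1] = x ^+ k * q.[x]]
    matches the term of degree [j] of [p] with that of degree [n - k - j] of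
    [q], and the terms of [p] that would have negative degree vanish. *)
Lemma coef_reversal n k p q :
  (forall x, x != 0 -> x ^+ n * p.[x^-1] = x ^+ k * q.[x]) ->
  (forall i j, (i + j + k = n)%N -> q`_i = p`_j) /\
  (forall j, (n < j + k)%N -> p`_j = 0).
Proof.
(* [r] is the polynomial [x ^ S * p (1 / x)]. *)
move=> pq; pose S := size p; pose r := \poly_(l < S.+1) p`_(S - l).
have rE x : x != 0 -> r.[x] = x ^+ S * p.[x^-1].
  move=> x0; rewrite horner_poly (reindex_inj rev_ord_inj) /=.
  rewrite (@horner_coef_wide _ S.+1 p) ?leqnSn// big_distrr /=.
  apply: eq_bigr => i _; rewrite subSS subKn; last by rewrite -ltnS.
  have iS : (i <= S)%N by rewrite -ltnS.
  have -> : x ^+ S = x ^+ (S - i) * x ^+ i by rewrite -exprD subnK.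
  rewrite exprVn; field; by rewrite expf_neq0.
have E : 'X^n * r = 'X^(k + S) * q.
  apply: (@eq_poly_off [:: 0]) => x; rewrite inE => x0.
  by rewrite !hornerE rE// mulrCA pq// exprD mulrA; ring.
have coefE l : (if (l < n)%N then 0 else r`_(l - n)) =
               (if (l < k + S)%N then 0 else q`_(l - (k + S))).
  by have := congr1 (fun P : {poly F} => P`_l) E; rewrite !coefXnM.
split=> [i j ijk|j njk].
  have [jS|jS] := leqP j S.
    have := coefE (i + k + S)%N.
    have -> : (i + k + S < n)%N = false by apply/negP; lia.
    have -> : (i + k + S < k + S)%N = false by apply/negP; lia.
    have -> : (i + k + S - (k + S) = i)%N by lia.
    move=> <-; rewrite coef_poly.
    have -> : (i + k + S - n < S.+1)%N by lia.
    by congr (nth _ _ _); lia.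
  rewrite (nth_default _ (ltnW jS)).
  have := coefE (i + k + S)%N.
  have -> : (i + k + S < n)%N by lia.
  have -> : (i + k + S < k + S)%N = false by apply/negP; lia.
  by have -> : (i + k + S - (k + S) = i)%N by lia.
have [jS|jS] := leqP j S; last by rewrite (nth_default _ (ltnW jS)).
have := coefE (n + (S - j))%N.
have -> : (n + (S - j) < n)%N = false by apply/negP; lia.
have -> : (n + (S - j) < k + S)%N by lia.
have -> : (n + (S - j) - n = S - j)%N by lia.
rewrite coef_poly ltnS leq_subr => E0; rewrite -[RHS]E0.
by congr (nth _ _ _); lia.
Qed.

Lemma deriv_factor_root p q x : p = q * ('X - x%:P) -> p^`().[x] = q.[x].
Proof.
by move=> ->; rewrite derivM derivXsubC !hornerE subrr mulr0 add0r.
Qed.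

(** Lagrange interpolation of [q] at the roots of [p], read off at the
    coefficient of degree [n]: this is the theorem that the residues of
    [q / p dx] add up to the opposite of the residue at infinity. *)
Lemma sum_residues p q n (rs : seq F) :
  size p = n.+2 -> (size q <= n.+1)%N ->
  p = lead_coef p *: \prod_(z <- rs) ('X - z%:P) ->
  (forall x, x \in rs -> p^`().[x] != 0) -> uniq rs ->
  \sum_(x <- rs) q.[x] / p^`().[x] = q`_n / p`_n.+1.
Proof.
move=> sp sq pE pd urs.
have lp : lead_coef p != 0 by rewrite lead_coef_eq0 -size_poly_gt0 sp.
have lpE : lead_coef p = p`_n.+1 by rewrite lead_coefE sp.
have szrs : size rs = n.+1.
  have := congr1 (fun P : {poly F} => size P) pE.
  by rewrite size_scale// size_prod_XsubC sp => -[].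
pose e x := lead_coef p *: \prod_(z <- rem x rs) ('X - z%:P).
have eE x : x \in rs -> p = e x * ('X - x%:P).
  by move=> xs; rewrite {1}pE (big_rem x)//= /e -scalerAl mulrC.
have szr x : x \in rs -> size (rem x rs) = n.
  by move=> xs; rewrite size_rem// szrs.
have qE : q = \sum_(x <- rs) (q.[x] / p^`().[x]) *: e x.
  apply/eqP; rewrite -subr_eq0; apply/negPn/negP => D0.
  set D := _ - _ in D0.
  have sD : (size D <= n.+1)%N.
    rewrite (leq_trans (size_polyD _ _))// geq_max sq /= size_polyN.
    rewrite (leq_trans (size_sum _ _ _))//; apply/bigmax_leqP_seq => x xs _.
    rewrite (leq_trans (size_scale_leq _ _))// size_scale//.
    by rewrite size_prod_XsubC szr.
  suff : (size rs < size D)%N by rewrite szrs ltnNge sD.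
  apply: (max_poly_roots D0 _ urs); apply/allP => x xs; apply/rootP.
  rewrite /D hornerD hornerN horner_sum (bigD1_seq x)//=.
  rewrite [X in _ - (_ + X)]big1_seq; last first.
    move=> y /andP[yx ys]; rewrite hornerZ.
    have xr : x \in rem y rs by rewrite (rem_filter _ urs) mem_filter /= eq_sym yx xs.
    have /rootP-> : root (e y) x by rewrite rootZ// root_prod_XsubC.
    by rewrite mulr0.
  have eN0 := pd _ xs.
  by rewrite addr0 hornerZ -(deriv_factor_root (eE _ xs)) divfK// subrr.
rewrite [in RHS]qE coef_sum big_distrl /=; apply: eq_big_seq => x xs.
rewrite coefZ /e coefZ.
have /monicP : \prod_(z <- rem x rs) ('X - z%:P) \is monic.
  exact: monic_prod_XsubC.
rewrite lead_coefE size_prod_XsubC szr//= => ->.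
by rewrite mulr1 lpE mulfK// -lpE.
Qed.

(** The first two identities say [b1 / a1 dx = b0 / a0 du + dx / x] for
    [u = x^-1]. Comparing coefficients, with [m = n + 2 - k], they give
    [c * a1`_i = - a0`_(m - i)] and [c * b1`_i = b0`_(m - 2 - i) - a0`_(m - 1 - i)],
    and [b0`_j = a0`_j.+1] for the other indices. If [a0] has degree [m], then
    [a1.[0]] is not 0 and the sum of the residues of [b0 / a0] is
    [b0`_(m - 1) / a0`_m = 1]. Otherwise [0] is a simple root of [a1], so [a0]
    has degree [m - 1]; the sum is [b0`_(m - 2) / a0`_(m - 1)], and the value at
    the point [0] is 1 minus this quotient. *)
Lemma sum_residues_P1 (a0 b0 a1 b1 : {poly F}) (c : F) n k rs :
  c != 0 ->
  (forall x, x != 0 -> x ^+ n * (- x ^+ 2 * a0.[x^-1]) = c * x ^+ k * a1.[x]) ->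
  (forall x, x != 0 ->
     x ^+ n * (b0.[x^-1] - x * a0.[x^-1]) = c * x ^+ k * b1.[x]) ->
  (forall x, root a0 x -> a0^`().[x] != 0) ->
  (root a1 0 -> a1^`().[0] != 0) ->
  a0 = lead_coef a0 *: \prod_(z <- rs) ('X - z%:P) -> uniq rs ->
  \sum_(x <- rs) b0.[x] / a0^`().[x] +
    (if root a1 0 then b1.[0] / a1^`().[0] else 0) = 1.
Proof.
move=> c0 aE bE a0d a1d a0E urs.
have [aC aC0] : (forall i j, (i + j + k = n + 2)%N -> ((- c) *: a1)`_i = a0`_j) /\
  (forall j, (n + 2 < j + k)%N -> a0`_j = 0).
  apply: coef_reversal => x x0; rewrite hornerZ exprD.
  by have := aE _ x0 => E; transitivity (- (c * x ^+ k * a1.[x])); [rewrite -E|]; ring.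
have [bC bC0] : (forall i j, (i + j + k = n + 1)%N ->
    (c *: b1)`_i = ('X * b0 - a0)`_j) /\
  (forall j, (n + 1 < j + k)%N -> ('X * b0 - a0)`_j = 0).
  apply: coef_reversal => x x0; rewrite hornerZ hornerD hornerN hornerM hornerX exprD.
  transitivity (c * x ^+ k * b1.[x]); last by ring.
  by rewrite -bE//; field.
have a0N0 : a0 != 0.
  apply/eqP => a00; have := a0d 0; rewrite a00 deriv0 horner0 eqxx root0.
  by move=> /(_ isT).
have kn : (k <= n + 2)%N.
  rewrite leqNgt; apply/negP => nk; have /eqP := aC0 (size a0).-1 ltac:(lia).
  by rewrite -lead_coefE lead_coef_eq0 (negPf a0N0).
(* [m] is a natural number because [a0] is not zero. *)
have [m mE] : {m | n + 2 = m + k}%N by exists (n + 2 - k)%N; rewrite subnK.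
have b0C j : (m <= j.+1)%N -> b0`_j = a0`_j.+1.
  move=> mj; have /eqP := bC0 j.+1 ltac:(lia).
  by rewrite coefB coefXM/= subr_eq0 => /eqP.
have a0C j : (m < j)%N -> a0`_j = 0 by move=> mj; apply: aC0; lia.
have szb : (size b0 <= m)%N.
  by apply/leq_sizeP => j mj; have -> := b0C j (leqW mj); exact: a0C.
have sza : (size a0 <= m.+1)%N by apply/leq_sizeP => j mj; rewrite a0C.
have a1_0 : (- c) * a1.[0] = a0`_m.
  by rewrite horner_coef0 -coefZ; apply: aC; lia.
have rs_root x : x \in rs -> root a0 x.
  by rewrite a0E rootZ ?lead_coef_eq0// root_prod_XsubC.
have rootE : root a1 0 = (a0`_m == 0).
  by rewrite -a1_0 mulf_eq0 oppr_eq0 (negPf c0).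
(* Whether the degree of [a0] is less than [m] decides whether the point
   [x = 0] contributes. *)
rewrite rootE; case: eqP => [am|/eqP am].
  case: m am mE b0C a0C szb sza a1_0 rootE => [|m] am mE b0C a0C szb sza a1_0 rootE.
    have : a0 == 0.
      by apply/eqP/polyP => -[|j]; rewrite coef0 ?am// a0C.
    by rewrite (negPf a0N0).
  have a1_1 : (- c) * a1`_1 = a0`_m by rewrite -coefZ; apply: aC; lia.
  have a1D : a1^`().[0] = a1`_1 by rewrite horner_coef0 coef_deriv.
  have am0 : a0`_m != 0.
    rewrite -a1_1 mulf_eq0 oppr_eq0 negb_or c0 /= -a1D; apply: a1d.
    by rewrite rootE am eqxx.
  have b1_0 : c * b1.[0] = (if m is m'.+1 then b0`_m' else 0) - a0`_m.
    rewrite horner_coef0 -coefZ (bC 0%N m ltac:(lia)) coefB coefXM.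
    by case: {+}m => [|m'].
  have sa0 : size a0 = m.+1.
    apply/eqP; rewrite eqn_leq; apply/andP; split.
      by apply/leq_sizeP => -[|j] // mj; have [->//|] := eqVneq j m; move=> ?; apply: a0C; lia.
    by rewrite ltnNge; apply/negP => /leq_sizeP/(_ m (leqnn _))/eqP; apply/negP.
  have a1N0 : a1`_1 != 0.
    by apply/eqP => a10; move: am0; rewrite -a1_1 a10 mulr0 eqxx.
  have CS1 : b1.[0] / a1^`().[0] = 1 - (if m is m'.+1 then b0`_m' else 0) / a0`_m.
    have -> : (if m is m'.+1 then b0`_m' else 0) = c * b1.[0] + a0`_m.
      by rewrite b1_0 subrK.
    by rewrite a1D -a1_1; field; rewrite c0 a1N0.
  rewrite CS1; case: m {CS1 mE a1_1} am b0C a0C szb sza a1_0 rootE am0 b1_0 sa0.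
    move=> am b0C a0C szb sza a1_0 rootE am0 b1_0 sa0.
    have -> : rs = [::].
      apply: size0nil.
      have := congr1 (fun P : {poly F} => size P) a0E.
      by rewrite size_scale ?lead_coef_eq0// size_prod_XsubC sa0 => -[].
    by rewrite big_nil mul0r subr0 add0r.
  move=> m am b0C a0C szb sza a1_0 rootE am0 b1_0 sa0.
  rewrite (@sum_residues a0 b0 m)//.
  - by rewrite addrC subrK.
  - apply/leq_sizeP => j mj; have [->|jm] := eqVneq j m.+1.
      by rewrite b0C// am.
    by rewrite b0C ?a0C//; lia.
  - by move=> x /rs_root /a0d.
case: m am mE b0C a0C szb sza a1_0 rootE => [|m] am mE b0C a0C szb sza a1_0 rootE.
  move: (bC0 0%N ltac:(lia)) => /eqP.
  by rewrite coefB coefXM /= sub0r oppr_eq0 (negPf am).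
rewrite addr0 (@sum_residues a0 b0 m)//.
- move: (bC0 m.+1 ltac:(lia)) => /eqP; rewrite coefB coefXM /= subr_eq0 => /eqP->.
  by rewrite divff.
- apply/eqP; rewrite eqn_leq sza ltnNge; apply/negP => /leq_sizeP/(_ m.+1 (leqnn _))/eqP.
  by apply/negP.
- by move=> x /rs_root /a0d.
Qed.

End UnivariatePolynomials.

Section Transfer.

Variable F : numClosedFieldType.
Implicit Types (p q a b : {poly F}).

Lemma reversal_exists p : exists N q, forall x, x != 0 ->
  q.[x] = x ^+ N * p.[x^-1].
Proof.
elim/poly_ind: p => [|p c [N [q qE]]].
  by exists 0%N, 0 => x _; rewrite !hrE ?mulr0.
exists N.+1, (q + c *: 'X^(N.+1)) => x x0.
rewrite hornerD hornerZ hornerXn qE// hornerD hornerM hornerX hornerC exprS.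
by field.
Qed.

(** On the overlap [x = u^-1] of the two charts, passing from one generator to
    the other multiplies both eigenvalues at a singular point by the same
    non-zero factor. *)
Lemma eigenvalues_transfer a0 b0 a1 b1 c n k u : c != 0 -> u != 0 ->
  (forall x, x != 0 -> x ^+ n * (- x ^+ 2 * a0.[x^-1]) = c * x ^+ k * a1.[x]) ->
  (forall x, x != 0 ->
     x ^+ n * (b0.[x^-1] - x * a0.[x^-1]) = c * x ^+ k * b1.[x]) ->
  root a1 u^-1 = root a0 u /\ (root a0 u ->
    exists2 d, d != 0 &
      a1^`().[u^-1] = d * a0^`().[u] /\ b1.[u^-1] = d * b0.[u]).
Proof.
move=> c0 u0 aE bE; pose s := u^-1.
have s0 : s != 0 by rewrite invr_eq0.
have su : s^-1 = u by rewrite invrK.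
have rootE : root a1 s = root a0 u.
  have := aE _ s0; rewrite su => E.
  apply/idP/idP => /rootP r0; move: E; rewrite r0 ?mulr0 => /eqP.
    by rewrite !mulf_eq0 oppr_eq0 !expf_eq0/= (negPf s0) !andbF.
  by rewrite eq_sym !mulf_eq0 (negPf c0) !expf_eq0/= (negPf s0) !andbF.
split=> // ra0; have ra1 : root a1 s by rewrite rootE.
have /factor_theorem[e0 e0E] := ra0; have /factor_theorem[e1 e1E] := ra1.
have [K [q qE]] := reversal_exists e0.
(* [x^-1 - u = - u / x * (x - s)]: cancel the common zero, and compare what is
   left at [s], where it gives the derivatives. *)
have E : u *: ('X^(n.+1) * q) = c *: ('X^(k + K) * e1).
  apply: (@eq_poly_off _ [:: 0; s]) => x; rewrite !inE negb_or => /andP[x0 xs].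
  have xsN0 : x - s != 0 by rewrite subr_eq0.
  apply: (mulIf xsN0); have := aE _ x0; rewrite e1E e0E !hrE => aEx.
  rewrite qE//.
  transitivity (x ^+ K * (c * x ^+ k * (e1.[x] * (x - s)))); last first.
    by rewrite exprD; ring.
  rewrite -aEx /s exprS; field; by rewrite x0 u0.
have := congr1 (fun P : {poly F} => P.[s]) E.
rewrite !hrE qE// su exprS exprD => Es.
have e01 : s ^+ n * e0.[u] = c * s ^+ k * e1.[s].
  apply: (mulfI (expf_neq0 K s0)); transitivity (c * (s ^+ k * s ^+ K * e1.[s])); last by ring.
  by rewrite -Es /s; field; rewrite u0.
exists (s ^+ n / (c * s ^+ k)).
  by rewrite mulf_neq0 ?invr_eq0 ?mulf_neq0 ?expf_neq0.
rewrite (deriv_factor_root e1E) (deriv_factor_root e0E).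
have ck : c * s ^+ k != 0 by rewrite mulf_neq0 ?expf_neq0.
split; apply: (mulfI ck).
  by rewrite -e01 mulrA mulrCA mulfV ?mulr1// mulrC.
have := bE _ s0; rewrite su (rootP ra0) mulr0 subr0 => <-.
by rewrite mulrA mulrCA mulfV ?mulr1// mulrC.
Qed.

End Transfer.

(** * Pairs of polynomials in two variables without common factor *)

Section BivariatePolynomials.

Variable F : numClosedFieldType.
Local Notation F2 := {poly {poly F}}.
Implicit Types (p q A B D G : F2) (x y t : F).

(** The outer variable runs along the horizontal axis, the inner one is the
    height. *)
Definition slice t : {poly {poly F}} -> {poly F} := map_poly (horner_eval t).

Lemma horner_slice t p x : (slice t p).[x] = p.[x, t].
Proof. by rewrite -{1}(hornerC x t) -[x%:P.[t]]horner_evalE horner_map. Qed.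

Lemma sliceM t p q : slice t (p * q) = slice t p * slice t q.
Proof. exact: rmorphM. Qed.

Lemma bipoly_fun0 p : (forall x y, p.[x, y] = 0) -> p = 0.
Proof.
move=> p0; apply/polyP => i; rewrite coef0; apply: poly_fun0 => y.
have : slice y p = 0 by apply: poly_fun0 => x; rewrite horner_slice.
by move/(congr1 (fun P : {poly F} => P`_i)); rewrite coef_map coef0.
Qed.

Lemma eq_bipoly_off_x0 p q :
  (forall x y, x != 0 -> p.[x, y] = q.[x, y]) -> p = q.
Proof.
move=> pq; apply/eqP; rewrite -subr_eq0.
have : 'X * (p - q) = 0.
  apply: bipoly_fun0 => x y; rewrite !hrE.
  have [->|x0] := eqVneq x 0; first by rewrite mul0r.
  by rewrite pq// subrr mulr0.
by move/eqP; rewrite mulf_eq0 polyX_eq0.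
Qed.

Lemma bipoly0_off_y0 p :
  (forall x y, y != 0 -> p.[x, y] = 0) -> p = 0.
Proof.
move=> p0.
have : 'X%:P * p = 0.
  apply: bipoly_fun0 => x y; rewrite !hrE.
  have [->|x0] := eqVneq y 0; first by rewrite mul0r.
  by rewrite p0// mulr0.
by move/eqP; rewrite mulf_eq0 polyC_eq0 polyX_eq0 => /eqP.
Qed.

Lemma slice_eq0_factor t p : slice t p = 0 ->
  p = ('X - t%:P)%:P * map_poly (fun c => c %/ ('X - t%:P)) p.
Proof.
move=> p0; apply/polyP => i.
rewrite coefCM coef_map_id0 ?div0p// mulrC divpK// dvdp_XsubCl; apply/rootP.
by have := congr1 (fun P : {poly F} => P`_i) p0; rewrite coef_map coef0.
Qed.

(** The quotient by the equation [y] of the horizontal axis, for polynomials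
    that vanish on it. *)
Definition divy : F2 -> F2 := map_poly (fun c => c %/ 'X).

Lemma divyE p : slice 0 p = 0 -> p = 'X%:P * divy p.
Proof. by move/slice_eq0_factor; rewrite subr0. Qed.

Lemma divyK p q : p = 'X%:P * q -> divy p = q.
Proof.
move=> pE; have X0 : ('X%:P : F2) != 0 by rewrite polyC_eq0 polyX_eq0.
apply: (mulfI X0); rewrite -divyE -?pE// pE sliceM.
by rewrite /slice map_polyC /= /horner_eval hornerX mul0r.
Qed.

(** Substituting fractions with denominator [d] for the two variables gives a
    fraction whose denominator is a power of [d]. *)
Lemma clear_denominators (d m1 m2 : F2) p : exists N q, forall x y,
  d.[x, y] != 0 ->
  q.[x, y] = d.[x, y] ^+ N * p.[m1.[x, y] / d.[x, y], m2.[x, y] / d.[x, y]].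
Proof.
elim/poly_ind: p => [|p c [N [q qE]]].
  by exists 0%N, 0 => x y _; rewrite !hrE ?mulr0.
have [M [r rE]] : exists M (r : F2), forall x y, d.[x, y] != 0 ->
    r.[x, y] = d.[x, y] ^+ M * c.[m2.[x, y] / d.[x, y]].
  elim/poly_ind: c => [|c a [M [r rE]]].
    by exists 0%N, 0 => x y _; rewrite !hrE ?mulr0.
  exists M.+1, (r * m2 + a%:P%:P * d ^+ M.+1) => x y d0.
  rewrite !hrE rE// exprS; field.
  by [].
exists (N + M).+1, (d ^+ M * (q * m1) + d ^+ N.+1 * r) => x y d0.
rewrite !hrE qE// rE// !exprS exprD; field.
by [].
Qed.

(** The algebraic form of the isolatedness of the common zeros: a Bezout
    relation with respect to the first variable, and no horizontal line of
    common zeros. *)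
Definition coprime2 A B :=
  (exists X Y (r : {poly F}), r != 0 /\ X * A + Y * B = r%:P) /\
  (forall t, ~ (slice t A = 0 /\ slice t B = 0)).

Lemma coprime2_neq0 A B : coprime2 A B -> ~ (A = 0 /\ B = 0).
Proof. by move=> [_ cAB] [A0 B0]; apply: (cAB 0); rewrite A0 B0 /slice !rmorph0. Qed.

(** Gauss lemma: the coefficient of the Bezout relation can be divided out one
    horizontal line at a time. *)
Lemma coprime2_collinear A B A' B' : coprime2 A B -> A * B' = A' * B ->
  exists G, A' = G * A /\ B' = G * B.
Proof.
move=> [[X [Y [r [r0 bez]]]] cAB] AB.
have : exists G, r%:P * A' = G * A /\ r%:P * B' = G * B.
  exists (X * A' + Y * B'); rewrite -bez; split.
    transitivity (X * A' * A + Y * (A' * B)); first by ring.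
    by rewrite -AB; ring.
  transitivity (X * (A * B') + Y * B' * B); first by ring.
  by rewrite AB; ring.
move=> [G [GA GB]] {X Y bez AB}.
elim: {r}(size r) {-2}r (leqnn (size r)) r0 G GA GB => [|n IH] r sr r0 G GA GB.
  by move: sr; rewrite leqn0 size_poly_eq0 (negPf r0).
have [/size_poly1P[c c0 rc]|sr1] := boolP (size r == 1%N).
  exists (c^-1%:P%:P * G); rewrite -!mulrA -GA -GB rc.
  by rewrite !mulrA -!polyCM mulVf// !mul1r.
have /closed_rootP[t /factor_theorem[r1 r1E]] := sr1.
have r10 : r1 != 0 by apply: contraNneq r0 => r10; rewrite r1E r10 mul0r.
have slr : slice t r%:P = 0.
  by rewrite /slice map_polyC /= r1E /horner_eval !hrE subrr mulr0.
have slG : slice t G = 0.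
  have /eqP := congr1 (slice t) GA; have /eqP := congr1 (slice t) GB.
  rewrite !sliceM slr !mul0r ![0 == _]eq_sym !mulf_eq0.
  case: eqP => //= _ /eqP B0 /eqP A0; by case: (cAB t).
have := slice_eq0_factor slG; set G1 := map_poly _ _ => G1E.
have Xt : (('X - t%:P)%:P : F2) != 0 by rewrite polyC_eq0 polyXsubC_eq0.
apply: (IH r1 _ r10 G1).
- by move: sr; rewrite r1E size_Mmonic ?monicXsubC// size_XsubC addn2.
- by apply: (mulfI Xt); rewrite mulrA [RHS]mulrA -G1E -GA r1E polyCM; ring.
- by apply: (mulfI Xt); rewrite mulrA [RHS]mulrA -G1E -GB r1E polyCM; ring.
Qed.

(** The two factors given by [coprime2_collinear] are inverse to each other,
    hence constant. *)
Lemma coprime2_proportional A B A' B' : coprime2 A B -> coprime2 A' B' ->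
  A * B' = A' * B -> exists2 c : F, c != 0 &
  A' = c%:P%:P * A /\ B' = c%:P%:P * B.
Proof.
move=> cAB cAB' E; have [G [GA GB]] := coprime2_collinear cAB E.
have [H [HA HB]] := coprime2_collinear cAB' (esym E).
have HG : H * G = 1.
  have := coprime2_neq0 cAB; have [A0 B0|A0 _] := eqVneq A 0.
    have {B0} B0 : B != 0 by apply: contra_notN B0 => /eqP B0; rewrite A0 B0.
    by apply: (mulIf B0); rewrite mul1r -mulrA -GB -HB.
  by apply: (mulIf A0); rewrite mul1r -mulrA -GA -HA.
have : G \is a GRing.unit by apply/unitrPr; exists H; rewrite mulrC.
rewrite poly_unitE => /andP[/size_poly1P[g g0 GE]].
rewrite GE coefC /= poly_unitE => /andP[/size_poly1P[c c0 gE] _].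
by exists c => //; rewrite -gE -GE.
Qed.

(** [rel_charts] says that the field [(A1, B1)] in the coordinates [(s, r)] and
    the image of [(A0, B0)] under the change of coordinates
    [(u, t) = (s^-1, r / s)] are collinear; this image is
    [(- s ^+ 2 * A0, s * B0 - r * s * A0)]. *)
Definition rel_charts A0 B0 A1 B1 := forall s r, s != 0 ->
  A1.[s, r] * (r * A0.[s^-1, r / s] - B0.[s^-1, r / s]) =
  s * A0.[s^-1, r / s] * B1.[s, r].

Lemma rel_charts_sym A0 B0 A1 B1 :
  rel_charts A0 B0 A1 B1 -> rel_charts A1 B1 A0 B0.
Proof.
move=> rel u t u0; have ui : u^-1 != 0 by rewrite invr_eq0.
have tE : (t / u) / u^-1 = t by rewrite invrK divfK.
have := rel u^-1 (t / u) ui; rewrite tE invrK => E.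
apply: (mulfI ui).
transitivity (A0.[u, t] * t * A1.[u^-1, t / u] / u - u^-1 * A0.[u, t] * B1.[u^-1, t / u]).
  by ring.
by rewrite -E; field.
Qed.

(** After multiplication by a power of [s] the image of [(A0, B0)] has
    polynomial components, and the Gauss lemma applies. *)
Lemma rel_charts_factor A0 B0 A1 B1 :
  coprime2 A1 B1 -> rel_charts A0 B0 A1 B1 ->
  exists N G, forall s r, s != 0 ->
   s ^+ N * (- s ^+ 2 * A0.[s^-1, r / s]) = G.[s, r] * A1.[s, r] /\
   s ^+ N * (s * B0.[s^-1, r / s] - r * s * A0.[s^-1, r / s]) =
     G.[s, r] * B1.[s, r].
Proof.
move=> c1 rel.
have [N [a aE]] := clear_denominators 'X 1%:P%:P 'X%:P A0.
have [M [b bE]] := clear_denominators 'X 1%:P%:P 'X%:P B0.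
have {}aE s r : s != 0 -> a.[s, r] = s ^+ N * A0.[s^-1, r / s].
  by move=> s0; have := aE s r; rewrite !hrE mul1r; apply.
have {}bE s r : s != 0 -> b.[s, r] = s ^+ M * B0.[s^-1, r / s].
  by move=> s0; have := bE s r; rewrite !hrE mul1r; apply.
pose WA := - 'X^(M + 2) * a; pose WB := 'X^(N.+1) * b - 'X^(M.+1) * 'X%:P * a.
have WAE s r : s != 0 -> WA.[s, r] = s ^+ (N + M) * (- s ^+ 2 * A0.[s^-1, r / s]).
  by move=> s0; rewrite !hrE aE// !exprD; ring.
have WBE s r : s != 0 -> WB.[s, r] =
    s ^+ (N + M) * (s * B0.[s^-1, r / s] - r * s * A0.[s^-1, r / s]).
  by move=> s0; rewrite !hrE aE// bE// !exprS !exprD; ring.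
clearbody WA WB; have [|G [GA GB]] := @coprime2_collinear A1 B1 WA WB c1.
  apply: eq_bipoly_off_x0 => s r s0; rewrite !hornerM WAE// WBE//.
  transitivity (- s ^+ (N + M) * s * (s * A0.[s^-1, r / s] * B1.[s, r])); last by ring.
  by rewrite -rel//; ring.
exists (N + M)%N, G => s r s0.
by rewrite -WAE// -WBE// GA GB !hornerM.
Qed.

(** The two collinearity factors, from each chart to the other, are inverse to
    each other up to a power of [s], so that on the common axis they are
    monomials. *)
Lemma rel_charts_monomial A0 B0 A1 B1 :
  coprime2 A0 B0 -> coprime2 A1 B1 -> rel_charts A0 B0 A1 B1 ->
  exists N G k c, [/\ c != 0, forall s, G.[s, 0] = c * s ^+ k & 
   forall s r, s != 0 ->
   s ^+ N * (- s ^+ 2 * A0.[s^-1, r / s]) = G.[s, r] * A1.[s, r] /\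
   s ^+ N * (s * B0.[s^-1, r / s] - r * s * A0.[s^-1, r / s]) =
     G.[s, r] * B1.[s, r]].
Proof.
move=> c0 c1 rel.
have [N [G GE]] := rel_charts_factor c1 rel.
have [M [H HE]] := rel_charts_factor c0 (rel_charts_sym rel).
have [K [h hE]] := reversal_exists (slice 0 H).
have key s : s != 0 -> A1.[s, 0] != 0 \/ B1.[s, 0] != 0 ->
    G.[s, 0] * h.[s] * s ^+ M = s ^+ (N + K).
  move=> s0 AB; have si : s^-1 != 0 by rewrite invr_eq0.
  have [GA GB] := GE s 0 s0; have [HA HB] := HE s^-1 0 si.
  move: GA GB HA HB; rewrite mul0r invrK !mul0r !subr0 => GA GB HA HB.
  rewrite hE// horner_slice exprD.
  have sM : s ^+ M * s^-1 ^+ M = 1 by rewrite -exprMn mulfV// expr1n.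
  case: AB => z.
    apply: (mulIf z); transitivity (s ^+ M * s ^+ K * H.[s^-1, 0] * (G.[s, 0] * A1.[s, 0])).
      by ring.
    rewrite -GA.
    transitivity (- s ^+ M * s ^+ K * s ^+ N * s ^+ 2 * (H.[s^-1, 0] * A0.[s^-1, 0])).
      by ring.
    rewrite -HA.
    transitivity (s ^+ N * s ^+ K * A1.[s, 0] * (s ^+ M * s^-1 ^+ M) * (s ^+ 2 * s^-1 ^+ 2)).
      by ring.
    by rewrite sM -exprMn mulfV// expr1n !mulr1.
  apply: (mulIf z); transitivity (s ^+ M * s ^+ K * H.[s^-1, 0] * (G.[s, 0] * B1.[s, 0])).
    by ring.
  rewrite -GB.
  transitivity (s ^+ M * s ^+ K * s ^+ N * s * (H.[s^-1, 0] * B0.[s^-1, 0])).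
    by ring.
  rewrite -HB.
  transitivity (s ^+ N * s ^+ K * B1.[s, 0] * (s ^+ M * s^-1 ^+ M) * (s * s^-1)).
    by ring.
  by rewrite sM mulfV// !mulr1.
(* One of the components of [(A1, B1)] does not vanish identically on the axis,
   so [key] holds at all but finitely many points of it. *)
have : slice 0 G * (h * 'X^M) = 'X^(N + K).
  pose P := if slice 0 A1 == 0 then slice 0 B1 else slice 0 A1.
  have P0 : P != 0.
    rewrite /P; have [A0'|//] := eqVneq (slice 0 A1) 0.
    by apply/eqP => B0'; case: c1 => _ /(_ 0); apply.
  have XP : 'X * P != 0 by rewrite mulf_neq0// polyX_eq0.
  apply: (mulIf XP); apply/eqP; rewrite -subr_eq0; apply/eqP.
  apply: poly_fun0 => s; rewrite !hrE horner_slice.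
  have [->|s0] := eqVneq s 0; first by rewrite mul0r !mulr0 subrr.
  have [->|Ps0] := eqVneq P.[s] 0; first by rewrite !mulr0 subrr.
  rewrite [G.[s, 0] * _]mulrA key ?subrr//.
  move: Ps0; rewrite /P; case: ifP => _; rewrite horner_slice; first by right.
  by left.
move=> E; have : slice 0 G %| ('X - 0%:P) ^+ (N + K).
  by rewrite subr0 -E dvdp_mulr.
case/dvdp_exp_XsubCP => k _; rewrite subr0 => /eqpP[[d e] /= /andP[d0 e0] dE].
exists N, G, k, (e / d); split=> //; first by rewrite mulf_eq0 invr_eq0 negb_or e0.
move=> s; rewrite -horner_slice; apply: (mulfI d0).
by have := congr1 (fun P : {poly F} => P.[s]) dE; rewrite !hrE => ->; field.
Qed.

(** The change of coordinates restricted to the common axis. When the axis is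
    invariant, dividing the transverse components by the equations [t] and [r]
    of the axis before restricting gives the third identity; its term
    [- x * A0] comes from [t = r / s]. *)
Lemma rel_charts_axis A0 B0 A1 B1 :
  coprime2 A0 B0 -> coprime2 A1 B1 -> rel_charts A0 B0 A1 B1 ->
  exists n k c, [/\ c != 0,
   forall x, x != 0 -> x ^+ n * (- x ^+ 2 * (slice 0 A0).[x^-1]) =
     c * x ^+ k * (slice 0 A1).[x],
   forall x, x != 0 -> x ^+ n * (x * (slice 0 B0).[x^-1]) =
     c * x ^+ k * (slice 0 B1).[x]
  & slice 0 B0 = 0 -> slice 0 B1 = 0 -> forall x, x != 0 ->
     x ^+ n * ((slice 0 (divy B0)).[x^-1] - x * (slice 0 A0).[x^-1]) =
     c * x ^+ k * (slice 0 (divy B1)).[x]].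
Proof.
move=> c0 c1 rel.
have [n [G [k [c [cN0 Gs GE]]]]] := rel_charts_monomial c0 c1 rel.
exists n, k, c; split=> //.
- move=> x x0; rewrite !horner_slice -Gs.
  by have [+ _] := GE x 0 x0; rewrite mul0r.
- move=> x x0; rewrite !horner_slice -Gs.
  by have [_] := GE x 0 x0; rewrite !mul0r subr0.
move=> /divyE; set b0 := divy B0 => B0E /divyE; set b1 := divy B1 => B1E x x0.
rewrite !horner_slice -Gs.
(* [ev p] is the polynomial [p (x^-1, r / x)] in [r]: for fixed [x] the identity
   is known for [r] non-zero and is needed at [r = 0]. *)
pose ev (p : F2) := p.[x^-1%:P] \Po (x^-1 *: 'X).
have evE p r : (ev p).[r] = p.[x^-1, r / x].
  by rewrite /ev horner_comp !hrE mulrC.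
have E : x ^+ n *: (ev b0 - x *: ev A0) = G.[x%:P] * b1.[x%:P].
  apply: (@eq_poly_off _ [:: 0]) => r; rewrite inE => r0.
  rewrite !hrE !evE; apply: (mulfI r0).
  have [_] := GE x r x0; rewrite B0E B1E !hrE => Gb.
  transitivity (G.[x, r] * (r * b1.[x, r])); last by ring.
  by rewrite -Gb; field.
have := congr1 (fun P : {poly F} => P.[0]) E.
by rewrite !hrE !evE mul0r.
Qed.

End BivariatePolynomials.

(** * Differentiation of polynomials, residues, isolated zeros *)

Section Calculus.

Variable C : numClosedFieldType.

Lemma is_diff_fst (q : C * C) : is_diff q (fst : C * C -> C) (fst : C * C -> C).
Proof.
apply: DiffDef; first by apply: linear_differentiable => y; exact: cvg_fst.
by rewrite diff_lin //= => y; exact: cvg_fst.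
Qed.

Lemma is_diff_snd (q : C * C) : is_diff q (snd : C * C -> C) (snd : C * C -> C).
Proof.
apply: DiffDef; first by apply: linear_differentiable => y; exact: cvg_snd.
by rewrite diff_lin //= => y; exact: cvg_snd.
Qed.

Lemma differentiable_poly (p : {poly C}) (x : C) :
  differentiable (fun x : C => p.[x]) x.
Proof.
elim/poly_ind: p => [|p c IH].
  have -> : (fun x : C => (0 : {poly C}).[x]) = cst 0.
    by apply/funext => y; rewrite horner0.
  exact: differentiable_cst.
have -> : (fun x : C => (p * 'X + c%:P).[x]) = (fun x => p.[x]) * id + cst c.
  by apply/funext => y; rewrite hornerD hornerM hornerX hornerC.
by apply: differentiableD; [exact: differentiableM|exact: differentiable_cst].
Qed.

Lemma continuous_poly (p : {poly C}) : continuous (fun x : C => p.[x]).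
Proof. by move=> x; exact/differentiable_continuous/differentiable_poly. Qed.
Arguments continuous_poly : clear implicits.

Lemma is_diff_poly_comp (g dg : C * C -> C) (q : C * C) (p : {poly C}) :
  is_diff q g dg -> is_diff q (fun q' => p.[g q']) (p^`().[g q] *: dg).
Proof.
move=> dgq; elim/poly_ind: p => [|p c IH].
  rewrite deriv0 horner0 scale0r.
  by under eq_fun do rewrite horner0; exact: is_diff_cst.
have -> : (fun q' => (p * 'X + c%:P).[g q']) = (fun q' => p.[g q']) * g + cst c.
  by apply/funext => y; rewrite hornerD hornerM hornerX hornerC.
apply: (is_diff_eq (is_diffD (is_diffM IH dgq) (is_diff_cst c q))).
by rewrite addr0 derivD derivM derivX derivC !hornerE/= scalerDl scalerA mulrC addrC.
Qed.

(** Only the partial derivative along the first axis is made explicit, since it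
    carries the eigenvalue along the line at infinity. *)
Lemma is_diff_bipoly (A : {poly {poly C}}) (q : C * C) : exists e,
  is_diff q (fun q' => A.[q'.1, q'.2])
   (fun h => h.1 * A^`().[q.1, q.2] + h.2 * e).
Proof.
elim/poly_ind: A => [|p c [e IH]].
  exists 0; under eq_fun do rewrite !horner0.
  rewrite deriv0 !horner0; apply: is_diff_eq; apply/funext => h /=.
  by rewrite !mulr0 addr0.
exists (e * q.1 + c^`().[q.2]).
have -> : (fun q' : C * C => (p * 'X + c%:P).[q'.1, q'.2]) =
    (fun q' => p.[q'.1, q'.2]) * fst + (fun q' => c.[q'.2]).
  by apply/funext => y; rewrite !(hornerD, hornerM, hornerX, hornerC).
have h1 := is_diff_fst q; have h2 := is_diff_poly_comp c (is_diff_snd q).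
have scE (a b : C) : a *: b = a * b by [].
apply: (is_diff_eq (is_diffD (is_diffM IH h1) h2)); apply/funext => h.
rewrite !fctE /= derivD derivM derivX derivC.
rewrite !(hornerD, hornerM, hornerX, hornerC, mulr1, addr0).
rewrite !scE; ring.
Qed.

Lemma near_neq0 (f : C -> C) (x : C) :
  {for x, continuous f} -> f x != 0 -> \forall s \near x, f s != 0.
Proof.
move=> fc fx0; have fx : 0 < `|f x| by rewrite normr_gt0.
apply: filterS (cvgr_dist_lt _ _ fc _ fx) => s.
by apply: contraTneq => ->; rewrite subr0 ltxx.
Qed.

Lemma near_exists_neq (x : C) (P : set C) :
  (\forall s \near x, P s) -> exists2 s, s != x & P s.
Proof.
move=> /nbhs_ballP[e e0 eP]; exists (x + e / 2).
  by rewrite -subr_eq0 addrC addKr mulf_neq0// ?gt_eqF// invr_eq0 pnatr_eq0.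
apply: eP; rewrite -ball_normE /= opprD addrA subrr sub0r normrN.
rewrite gtr0_norm ?divr_gt0 ?ltr0n//.
by rewrite ltr_pdivrMr ?ltr0n// mulr_natr mulr2n ltrDl.
Qed.

End Calculus.

Section LaurentExpansions.

Variable C : numClosedFieldType.

Lemma laurent_simple_pole (a b : {poly C}) : root a 0 -> a^`().[0] != 0 ->
  exists h : C -> C, (\forall s \near (0 : C), differentiable h s) /\
    \forall s \near (0 : C), s != 0 ->
      b.[s] / a.[s] = b.[0] / a^`().[0] / s + h s.
Proof.
move=> /factor_theorem[e aE] a'0; set c := _ / _.
have e0 : e.[0] != 0 by rewrite -(deriv_factor_root aE).
have : root (b - c *: e) 0.
  by apply/rootP; rewrite !hrE /c (deriv_factor_root aE) divfK// subrr.
case/factor_theorem => g gE.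
have en := near_neq0 (@continuous_poly _ e 0) e0.
exists (fun s => g.[s] / e.[s]); split.
- near=> s; have es : e.[s] != 0 by near: s; exact: en.
  apply: (@differentiableM _ _ (fun s : C => g.[s]) (fun s : C => (e.[s])^-1)).
    exact: differentiable_poly.
  exact/differentiableV/es/differentiable_poly.
- near=> s => s0; have es : e.[s] != 0 by near: s; exact: en.
  rewrite aE !hrE subr0.
  have := congr1 (fun P : {poly C} => P.[s]) gE; rewrite !hrE subr0 => E.
  have -> : b.[s] = c * e.[s] + g.[s] * s by rewrite -E addrC subrK.
  by field; rewrite es s0.
Unshelve. all: by end_near. Qed.

(** The difference [P] of the two principal parts, multiplied by [s ^+ m.+1], is
    a polynomial of degree at most [m] and equals [s ^+ m.+1] times a function
    continuous at 0; so its order of vanishing at 0 would exceed its degree if it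
    were not zero. *)
Lemma laurent_residue_uniq (f h h' : C -> C) n n' (l l' : nat -> C) :
  (\forall s \near (0 : C), differentiable h s) ->
  (\forall s \near (0 : C), s != 0 ->
     f s = (\sum_(k < n.+1) l k / s ^+ k.+1) + h s) ->
  (\forall s \near (0 : C), differentiable h' s) ->
  (\forall s \near (0 : C), s != 0 ->
     f s = (\sum_(k < n'.+1) l' k / s ^+ k.+1) + h' s) ->
  l 0%N = l' 0%N.
Proof.
move=> dh fE dh' fE'; pose pad (u : nat -> C) N k := if (k < N.+1)%N then u k else 0.
have sum_pad (u : nat -> C) N m s : (N <= m)%N ->
    \sum_(k < N.+1) u k / s ^+ k.+1 = \sum_(k < m.+1) pad u N k / s ^+ k.+1.
  move=> Nm; rewrite (big_ord_widen m.+1 (fun k => u k / s ^+ k.+1))//.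
  rewrite big_mkcond/=; apply: eq_bigr => k _; rewrite /pad.
  by case: ifP => _ //; rewrite mul0r.
pose m := maxn n n'.
pose P := \poly_(i < m.+1) (pad l n (m - i)%N - pad l' n' (m - i)%N).
have PE (s : C) : s != 0 -> P.[s] = s ^+ m.+1 *
    (\sum_(k < n.+1) l k / s ^+ k.+1 - \sum_(k < n'.+1) l' k / s ^+ k.+1).
  move=> s0; rewrite (sum_pad l n m s (leq_maxl _ _)) (sum_pad l' n' m s (leq_maxr _ _)).
  rewrite -sumrB horner_poly (reindex_inj rev_ord_inj) big_distrr /=.
  apply: eq_bigr => k _; rewrite subSS subKn; last by rewrite -ltnS.
  have -> : s ^+ m.+1 = s ^+ (m - k) * s ^+ k.+1.
    by rewrite -exprD addnS subnK// -ltnS.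
  by field; rewrite expf_neq0.
suff P0 : P = 0.
  have := congr1 (fun Q : {poly C} => Q`_m) P0.
  rewrite coef_poly ltnSn subnn coef0 /pad !ltn0Sn => /eqP.
  by rewrite subr_eq0 => /eqP.
apply/eqP/negPn/negP => PN0.
have [j [Q]] := multiplicity_XsubC P 0; rewrite PN0 /= => Q0 PQ.
have QN0 : Q != 0 by apply: contra_neq PN0 => Q00; rewrite PQ Q00 mul0r.
have jm : (j <= m)%N.
  have : (size P <= m.+1)%N by exact: size_poly.
  rewrite PQ subr0 size_mulXn// => sQ.
  by rewrite -ltnS (leq_trans _ sQ)// -addn1 leq_add2l size_poly_gt0.
pose F (s : C) := Q.[s] - s ^+ (m - j).+1 * (h' s - h s).
have h0 : {for 0, continuous h}.
  exact/differentiable_continuous/(nbhs_singleton dh).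
have h'0 : {for 0, continuous h'}.
  exact/differentiable_continuous/(nbhs_singleton dh').
have Fc : {for 0, continuous F}.
  have c1 : (fun s : C => Q.[s]) @ (0 : C) --> Q.[0] by exact: (@continuous_poly _ Q 0).
  have c2 : (fun s : C => s ^+ (m - j).+1) @ (0 : C) --> (0 : C) ^+ (m - j).+1.
    have := @continuous_poly _ ('X^((m - j).+1)) (0 : C).
    by rewrite /continuous_at hornerXn; under eq_fun do rewrite hornerXn.
  exact: (cvgB c1 (cvgM c2 (cvgB h'0 h0))).
have F0 : F 0 != 0 by rewrite /F expr0n mul0r subr0.
have : \forall s \near (0 : C), [/\ F s != 0,
    s != 0 -> f s = \sum_(k < n.+1) l k / s ^+ k.+1 + h s &
    s != 0 -> f s = \sum_(k < n'.+1) l' k / s ^+ k.+1 + h' s].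
  near=> s; split; near: s => //.
  exact: near_neq0.
move=> /near_exists_neq[s s0 [+ /(_ s0) f1 /(_ s0) f2]].
apply/negP/negPn; rewrite /F subr_eq0; apply/eqP.
apply: (mulIf (expf_neq0 j s0)).
have : P.[s] = Q.[s] * s ^+ j by rewrite PQ subr0 !hrE.
move=> <-; rewrite PE//.
have -> : \sum_(k < n.+1) l k / s ^+ k.+1 = f s - h s by rewrite f1 addrK.
have -> : \sum_(k < n'.+1) l' k / s ^+ k.+1 = f s - h' s by rewrite f2 addrK.
have -> : s ^+ m.+1 = s ^+ (m - j).+1 * s ^+ j by rewrite -exprD addSn subnK.
by ring.
Unshelve. all: by end_near. Qed.

End LaurentExpansions.

Section Residues.

Variable R : realType.
Local Notation C := (CC R).

Lemma residue_simple_pole (a b : {poly C}) : root a 0 -> a^`().[0] != 0 ->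
  is_residue0 (fun s => b.[s] / a.[s]) (b.[0] / a^`().[0]).
Proof.
move=> a0 a'0; have [h [dh fE]] := laurent_simple_pole b a0 a'0.
exists 0%N, (fun=> b.[0] / a^`().[0]), h; split=> //.
by apply: filterS fE => s fE s0; rewrite big_ord1 expr1 fE.
Qed.

Lemma is_residue0_uniq (f : C -> C) (c c' : C) :
  is_residue0 f c -> is_residue0 f c' -> c = c'.
Proof.
move=> [n [l [h [dh fE <-]]]] [n' [l' [h' [dh' fE' <-]]]].
exact: laurent_residue_uniq dh fE dh' fE'.
Qed.

End Residues.

Section NearbyZeros.

Variable C : numClosedFieldType.

Lemma poly_nonroot (p : {poly C}) : p != 0 -> exists x, p.[x] != 0.
Proof.
by apply: contra_neqP => h; apply: poly_fun0 => x; apply: contra_notP h => /eqP; exists x.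
Qed.

Lemma prod_dist_ge (rs : seq C) (x e : C) : 0 <= e ->
  (forall z, z \in rs -> e <= `|x - z|) ->
  e ^+ size rs <= `|(\prod_(z <- rs) ('X - z%:P)).[x]|.
Proof.
move=> e0; elim: rs => [|z rs IH] h.
  by rewrite big_nil hrE normr1.
rewrite big_cons !hrE normrM exprS ler_pM ?exprn_ge0 ?h ?mem_head//.
by apply: IH => y yrs; rewrite h// inE yrs orbT.
Qed.

(** The roots of the slices of [D] depend continuously on the height [t], as
    long as the degree does not drop: [`|D.[x0, t]|] is [`|(lead_coef D).[t]|]
    times the product of the distances from [x0] to the roots at height [t], and
    it tends to 0 as [t] tends to [t0], so one of these distances is small. *)
Lemma nearby_zero (D : {poly {poly C}}) (P : {poly C}) x0 t0 (e : C) :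
  D.[x0, t0] = 0 -> (lead_coef D).[t0] != 0 -> P.[t0] != 0 -> 0 < e ->
  exists x t, [/\ t != t0, `|x0 - x| < e, `|t0 - t| < e, P.[t] != 0
                & D.[x, t] = 0].
Proof.
move=> D0 l0 P0 e0; set l := lead_coef D in l0 *; pose n := (size D).-1.
pose L := `|l.[t0]|; have L0 : 0 < L / 2 by rewrite divr_gt0 ?normr_gt0 ?ltr0n.
have : \forall t \near t0, [/\ `|t0 - t| < e, P.[t] != 0,
    `|l.[t0] - l.[t]| < L / 2 & `|D.[x0, t0] - D.[x0, t]| < L / 2 * e ^+ n].
  near=> t; split; near: t.
  - by have := nbhsx_ballx t0 e e0; rewrite -ball_normE.
  - exact: near_neq0 (@continuous_poly _ P t0) P0.
  - exact: (cvgr_dist_lt _ _ (@continuous_poly _ l t0) _ L0).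
  - apply: (cvgr_dist_lt _ _ (@continuous_poly _ D.[x0%:P] t0) _ _).
    by rewrite mulr_gt0// exprn_gt0.
case/near_exists_neq => t tt0 [te Pt lt]; rewrite D0 sub0r normrN => Dt.
have Llt : L / 2 < `|l.[t]|.
  have := lt_le_trans lt (lexx _); rewrite -(ltrD2r `|l.[t]|) => lt'.
  have le : L <= `|l.[t0] - l.[t]| + `|l.[t]| by rewrite -lerBlDr lerB_dist.
  by have := le_lt_trans le lt'; rewrite {1}[L]splitr ltrD2l.
have lt0 : l.[t] != 0 by rewrite -normr_gt0 (lt_trans L0).
have [rs sE] := closed_field_poly_normal (slice t D).
have lE : lead_coef (slice t D) = l.[t].
  by rewrite /slice lead_coef_map_id0 ?rmorph0.
have sz : size rs = n.
  rewrite /n -(@size_map_poly_id0 _ _ (horner_eval t))// -[map_poly _ _]/(slice t D).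
  by rewrite sE size_scale ?lE// size_prod_XsubC.
have [x xrs xe] : exists2 x, x \in rs & `|x0 - x| < e.
  apply: contrapT => far; have : e ^+ n <= `|(\prod_(z <- rs) ('X - z%:P)).[x0]|.
    rewrite -sz; apply: prod_dist_ge => [|z zrs]; first exact: ltW.
    rewrite real_leNgt ?normr_real ?gtr0_real//; apply/negP => ze.
    by apply: far; exists z.
  move=> le; have := lt_le_trans Dt (ler_pM (ltW L0) (exprn_ge0 n (ltW e0)) (ltW Llt) le).
  by rewrite -normrM -hornerZ -lE -sE horner_slice ltxx.
exists x, t; split=> //; rewrite -horner_slice; apply/rootP.
by rewrite sE rootZ ?lE// root_prod_XsubC.
Unshelve. all: by end_near. Qed.

End NearbyZeros.

Section IsolatedZeros.

Variable R : realType.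
Local Notation C := (CC R).

Lemma vf_eq0 (w : polyvf R) x y :
  vf w (x, y) = 0 <-> w.1.[x, y] = 0 /\ w.2.[x, y] = 0.
Proof.
split=> [E|[A0 B0]]; first by split; [exact: (congr1 fst E)|exact: (congr1 snd E)].
by rewrite /vf /= A0 B0.
Qed.

Lemma isolated_zeros_ball (f : C * C -> C * C) x0 y0 :
  isolated_zeros f -> f (x0, y0) = 0 ->
  exists2 e : C, 0 < e & forall x y,
    `|x0 - x| < e -> `|y0 - y| < e -> f (x, y) = 0 -> (x, y) = (x0, y0).
Proof.
move=> /[apply] /nbhs_ballP[e e0 h]; exists e => // x y xe ye fxy.
by apply: h => //; rewrite /ball /= /prod_ball -!ball_normE.
Qed.

(** If the greatest common divisor [D] of the components over the field of
    fractions in the second variable had positive degree, its zeros at all but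
    finitely many heights would be common zeros of the components, and they are
    not isolated by [nearby_zero]. If [D] has degree 0, Bezout applies. *)
Lemma isolated_zeros_coprime2 (w : polyvf R) :
  isolated_zeros (vf w) -> coprime2 w.1 w.2.
Proof.
case: w => A B iso /=.
have lines t : ~ (slice t A = 0 /\ slice t B = 0).
  case=> At Bt; have z x : vf (A, B) (x, t) = 0.
    by apply/vf_eq0; rewrite /= -!horner_slice At Bt horner0.
  have [e e0 h] := isolated_zeros_ball iso (z 0).
  have : \forall x \near (0 : C), `|0 - x| < e.
    by have := nbhsx_ballx (0 : C) e e0; rewrite -ball_normE.
  case/near_exists_neq => x x0 xe.
  have te : `|t - t| < e by rewrite subrr normr0.
  have /(congr1 fst)/= x00 := h x t xe te (z x).
  by rewrite x00 eqxx in x0.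
split=> //.
have AB0 : Pdiv.Idomain.gcdp A B != 0.
  rewrite Pdiv.Idomain.gcdp_eq0; apply/negP => /andP[/eqP A0 /eqP B0].
  by apply: (lines 0); rewrite A0 B0 /slice !rmorph0.
set D := Pdiv.Idomain.gcdp A B in AB0.
have [sD|sD] := leqP (size D) 1.
  have [[X Y] /= /Pdiv.Idomain.eqpP[[d d'] /= /andP[d0 d'0] E]] := Pdiv.Idomain.Bezoutp A B.
  have DE : D = (D`_0)%:P by rewrite {1}(size1_polyC sD).
  have D0 : D`_0 != 0 by apply: contra_neq AB0 => D00; rewrite DE D00.
  exists (d *: X), (d *: Y), (d' * D`_0); split; first by rewrite mulf_neq0.
  by rewrite -!scalerAl -scalerDr E -/D DE polyCM mul_polyC coefC.
exfalso.
have /Pdiv.Idomain.dvdpP[[r qA] /= r0 rA] : Pdiv.Idomain.dvdp D A.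
  exact: Pdiv.Idomain.dvdp_gcdl.
have /Pdiv.Idomain.dvdpP[[r' qB] /= r'0 rB] : Pdiv.Idomain.dvdp D B.
  exact: Pdiv.Idomain.dvdp_gcdr.
have D0 : lead_coef D != 0 by rewrite lead_coef_eq0.
have zero x t : (r * r').[t] != 0 -> D.[x, t] = 0 -> vf (A, B) (x, t) = 0.
  rewrite hornerM mulf_eq0 negb_or => /andP[rt r't] Dxt; apply/vf_eq0 => /=; split.
    apply: (mulfI rt); have := congr1 (fun P : {poly {poly C}} => P.[x, t]) rA.
    by rewrite !hrE Dxt !mulr0 => ->.
  apply: (mulfI r't); have := congr1 (fun P : {poly {poly C}} => P.[x, t]) rB.
  by rewrite !hrE Dxt !mulr0 => ->.
have [t0] : exists t, (r * r' * lead_coef D).[t] != 0.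
  by apply: poly_nonroot; rewrite !mulf_neq0.
rewrite hornerM mulf_eq0 negb_or => /andP[P0 l0].
have [x0 Dx0] : exists x, D.[x, t0] = 0.
  have /closed_rootP[x /rootP] : size (slice t0 D) != 1%N.
    by rewrite /slice size_map_poly_id0// gtn_eqF.
  by rewrite horner_slice => ?; exists x.
have [e e0 h] := isolated_zeros_ball iso (zero _ _ P0 Dx0).
have [x [t [tt0 xe te Pt Dt]]] := nearby_zero Dx0 l0 P0 e0.
have /(congr1 snd)/= tE := h _ _ xe te (zero _ _ Pt Dt).
by rewrite tE eqxx in tt0.
Qed.

End IsolatedZeros.

(** * Generators of the foliation in the two charts at infinity *)

Section Density.

Variable F : numClosedFieldType.
Local Notation F2 := {poly {poly F}}.

Lemma bipoly0_off_axes (p : F2) :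
  (forall x y, x != 0 -> y != 0 -> p.[x, y] = 0) -> p = 0.
Proof.
move=> p0; have : 'X * p = 0.
  apply: bipoly0_off_y0 => x y y0; rewrite !hrE.
  have [->|x0] := eqVneq x 0; first by rewrite mul0r.
  by rewrite p0// mulr0.
by move/eqP; rewrite mulf_eq0 polyX_eq0 => /eqP.
Qed.

(** [E] vanishes wherever [P], read through the rational change of coordinates
    [(m1 / t, m2 / t)], does not. As the latter hits all points with non-zero
    coordinates, [P] remains non-zero as a polynomial in [(u, t)], so it can be
    cancelled. *)
Lemma density (m1 m2 P E : F2) : P != 0 ->
  (forall x y, x != 0 -> y != 0 -> exists u t,
     t != 0 /\ m1.[u, t] / t = x /\ m2.[u, t] / t = y) ->
  (forall u t, u != 0 -> t != 0 ->
     P.[m1.[u, t] / t, m2.[u, t] / t] != 0 -> E.[u, t] = 0) ->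
  E = 0.
Proof.
move=> P0 msurj E0; have [N [q qE]] := clear_denominators 'X%:P m1 m2 P.
have {}qE u t : t != 0 -> q.[u, t] = t ^+ N * P.[m1.[u, t] / t, m2.[u, t] / t].
  by move=> t0; have := qE u t; rewrite !hrE; apply.
have q0 : q != 0.
  apply: contra_neq P0 => q0; apply: bipoly0_off_axes => x y x0 y0.
  have [u [t [t0 [<- <-]]]] := msurj x y x0 y0.
  apply: (mulfI (expf_neq0 N t0)).
  by rewrite mulr0 -qE// q0 !hrE.
apply: (mulIf q0); rewrite mul0r; apply: bipoly0_off_axes => u t u0 t0.
rewrite hornerM hornerM qE//.
have [->|Pn] := eqVneq (P.[m1.[u, t] / t, m2.[u, t] / t]) 0.
  by rewrite !mulr0.
by rewrite E0// mul0r.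
Qed.

Lemma cross_collinear (a b c d P Q : F) : (P != 0) || (Q != 0) ->
  a * Q = b * P -> c * Q = d * P -> a * d = b * c.
Proof.
move=> /orP[P0|Q0] ab cd.
  apply: (mulIf P0); rewrite -mulrA -cd; transitivity (a * Q * c); first by ring.
  by rewrite ab; ring.
apply: (mulIf Q0); transitivity (a * Q * d); first by ring.
by rewrite ab -mulrA -mulrA cd; ring.
Qed.

(** [(- B / t ^+ 2, A / t - u * B / t ^+ 2)] is the image of [(A, B)] in the
    coordinates [(1 / t, u / t)]. *)
Lemma same_chart_cross (A B A' B' u t : F) : t != 0 ->
  (- B / t ^+ 2) * (A' / t - u * B' / t ^+ 2) =
  (A / t - u * B / t ^+ 2) * (- B' / t ^+ 2) -> A * B' = A' * B.
Proof.
move=> t0 E; apply/eqP; rewrite -subr_eq0.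
have -> : A * B' - A' * B = t ^+ 3 *
    ((- B / t ^+ 2) * (A' / t - u * B' / t ^+ 2) -
     (A / t - u * B / t ^+ 2) * (- B' / t ^+ 2)) by field.
by rewrite E subrr mulr0.
Qed.

(** The collinearity of the images of [(A0, B0)] and [(A1, B1)] in the affine
    plane, where the first is taken at the point [(s^-1, r / s)]. *)
Lemma two_charts_cross (A0 B0 A1 B1 s r : F) : s != 0 -> r != 0 ->
  (- B0 / (r / s) ^+ 2) * (- B1 / r ^+ 2) =
  (A0 / (r / s) - s^-1 * B0 / (r / s) ^+ 2) * (A1 / r - s * B1 / r ^+ 2) ->
  A1 * (r * A0 - B0) = s * A0 * B1.
Proof.
move=> s0 r0 E; apply/eqP; rewrite -subr_eq0.
have -> : A1 * (r * A0 - B0) - s * A0 * B1 = r ^+ 3 / s *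
  ((A0 / (r / s) - s^-1 * B0 / (r / s) ^+ 2) * (A1 / r - s * B1 / r ^+ 2)
  - (- B0 / (r / s) ^+ 2) * (- B1 / r ^+ 2)) by field; rewrite s0 r0.
by rewrite E subrr mulr0.
Qed.

Lemma is_diff_inv_snd (q : F * F) : q.2 != 0 ->
  is_diff q (fun q : F * F => q.2^-1) (fun h : F * F => - h.2 / q.2 ^+ 2).
Proof.
move=> q0; have [dsnd sndE] := is_diff_snd q.
apply: DiffDef; first exact: differentiableV.
rewrite (diffV dsnd q0); apply/funext => h /=; rewrite sndE.
have scE (a b : F) : a *: b = a * b by [].
by rewrite scE mulrC mulNr mulrN.
Qed.

Lemma is_diff_ratio (q : F * F) : q.2 != 0 ->
  is_diff q (fun q : F * F => q.1 / q.2)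
    (fun h : F * F => h.1 / q.2 - q.1 * h.2 / q.2 ^+ 2).
Proof.
move=> q0; have scE (a b : F) : a *: b = a * b by [].
apply: (is_diff_eq (is_diffM (is_diff_fst q) (is_diff_inv_snd q0))).
by apply/funext => h; rewrite !fctE !scE; ring.
Qed.

Lemma uniq_simple_roots (rs : seq F) :
  (forall x, x \in rs -> (\prod_(z <- rs) ('X - z%:P))^`().[x] != 0) -> uniq rs.
Proof.
elim: rs => [//|z rs IH] h /=; apply/andP; split.
  have := h z (mem_head _ _); rewrite big_cons derivM derivXsubC !hrE subrr.
  by rewrite mul0r addr0 mul1r -rootE root_prod_XsubC.
apply: IH => x xrs; have := h x; rewrite inE xrs orbT => /(_ isT).
rewrite big_cons derivM derivXsubC !hrE mul1r.
have /rootP -> : root (\prod_(z <- rs) ('X - z%:P)) x by rewrite root_prod_XsubC.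
by rewrite add0r mulf_eq0 negb_or => /andP[].
Qed.

End Density.

Section Charts.

Variable R : realType.
Local Notation C := (CC R).

Lemma k1E : k1 = lift ord0 ord0.
Proof. by apply: val_inj; rewrite /= inordK. Qed.

Lemma chart_cases (k : 'I_3) : [\/ k = k0, k = k1 | k = k2].
Proof.
case: k => [[|[|[|//]]] kl]; [constructor 1|constructor 2|constructor 3];
by apply: val_inj; rewrite //= inordK.
Qed.

Lemma homog0E (q : C * C) : homog k0 q = \row_j [:: 1; q.1; q.2]`_j.
Proof.
apply/rowP => j; rewrite !mxE; case: unliftP => [[[|[|//]] il] ->|->] //.
Qed.

Lemma homog1E (q : C * C) : homog k1 q = \row_j [:: q.1; 1; q.2]`_j.
Proof.
apply/rowP => j; rewrite !mxE k1E; case: unliftP => [[[|[|//]] il] ->|->] //.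
Qed.

Lemma homog2E (q : C * C) : homog k2 q = \row_j [:: q.1; q.2; 1]`_j.
Proof.
apply/rowP => j; rewrite !mxE; case: unliftP => [[[|[|//]] il] ->|->] //.
Qed.

Lemma affine_coord_homog0 :
  affine_coord (R := R) \o homog k0 = fun q : C * C => (q.2^-1, q.1 / q.2).
Proof. by apply/funext => q; rewrite /= /affine_coord homog0E !mxE/= inordK// mul1r. Qed.

Lemma affine_coord_homog1 :
  affine_coord (R := R) \o homog k1 = fun q : C * C => (q.1 / q.2, q.2^-1).
Proof. by apply/funext => q; rewrite /= /affine_coord homog1E !mxE/= inordK// mul1r. Qed.

(** In the first chart the affine coordinates are [(1 / t, u / t)], and in the
    second one [(s / r, 1 / r)]. *)
Lemma generates0 v w (u t : C) : generates v k0 w -> t != 0 ->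
  (- w.2.[u, t] / t ^+ 2) * v.2.[t^-1, u / t] =
  (w.1.[u, t] / t - u * w.2.[u, t] / t ^+ 2) * v.1.[t^-1, u / t].
Proof.
move=> [_ gen] t0.
have tn : homog k0 (u, t) ord0 ord_max != 0 by rewrite homog0E mxE.
have hq := congr1 (fun f : C * C -> C * C => f (u, t)) affine_coord_homog0.
move: (gen _ tn); rewrite -[affine_coord (homog _ _)]/((affine_coord (R := R) \o homog k0) (u, t)) hq.
rewrite affine_coord_homog0.
have d2 := @is_diff_inv_snd C (u, t) t0; have d1 := @is_diff_ratio C (u, t) t0.
by have /@diff_val -> := is_diff_pair d2 d1.
Qed.

Lemma generates1 v w (s r : C) : generates v k1 w -> r != 0 ->
  (w.1.[s, r] / r - s * w.2.[s, r] / r ^+ 2) * v.2.[s / r, r^-1] =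
  (- w.2.[s, r] / r ^+ 2) * v.1.[s / r, r^-1].
Proof.
move=> [_ gen] r0.
have rn : homog k1 (s, r) ord0 ord_max != 0 by rewrite homog1E mxE.
have hq := congr1 (fun f : C * C -> C * C => f (s, r)) affine_coord_homog1.
move: (gen _ rn); rewrite -[affine_coord (homog _ _)]/((affine_coord (R := R) \o homog k1) (s, r)) hq.
rewrite affine_coord_homog1.
have d2 := @is_diff_inv_snd C (s, r) r0; have d1 := @is_diff_ratio C (s, r) r0.
by have /@diff_val -> := is_diff_pair d1 d2.
Qed.

End Charts.

Section Collinearity.

Variable C : numClosedFieldType.
Local Notation F2 := {poly {poly C}}.

Lemma same_chart_density (P Q m1 m2 A B A' B' : F2) : (P != 0) || (Q != 0) ->
  (forall x y, x != 0 -> y != 0 -> exists u t,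
     t != 0 /\ m1.[u, t] / t = x /\ m2.[u, t] / t = y) ->
  (forall u t, t != 0 ->
     (P.[m1.[u, t] / t, m2.[u, t] / t] != 0) ||
     (Q.[m1.[u, t] / t, m2.[u, t] / t] != 0) ->
     A.[u, t] * B'.[u, t] = A'.[u, t] * B.[u, t]) ->
  A * B' = A' * B.
Proof.
move=> PQ0 msurj E; apply/eqP; rewrite -subr_eq0; apply/eqP.
case/orP: PQ0 => [P0|Q0].
  apply: (density P0 msurj) => u t _ t0 Pn; rewrite !hrE E ?subrr//.
  by rewrite Pn.
apply: (density Q0 msurj) => u t _ t0 Qn; rewrite !hrE E ?subrr//.
by rewrite Qn orbT.
Qed.

Lemma two_charts_density (P Q A0 B0 A1 B1 : F2) : (P != 0) || (Q != 0) ->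
  (forall s r, s != 0 -> r != 0 ->
     (P.[s / r, r^-1] != 0) || (Q.[s / r, r^-1] != 0) ->
     A1.[s, r] * (r * A0.[s^-1, r / s] - B0.[s^-1, r / s]) =
     s * A0.[s^-1, r / s] * B1.[s, r]) ->
  rel_charts A0 B0 A1 B1.
Proof.
move=> PQ0 rel.
have [N [a aE]] := clear_denominators 'X 1%:P%:P 'X%:P A0.
have [M [b bE]] := clear_denominators 'X 1%:P%:P 'X%:P B0.
have {}aE s r : s != 0 -> a.[s, r] = s ^+ N * A0.[s^-1, r / s].
  by move=> s0; have := aE s r; rewrite !hrE mul1r; apply.
have {}bE s r : s != 0 -> b.[s, r] = s ^+ M * B0.[s^-1, r / s].
  by move=> s0; have := bE s r; rewrite !hrE mul1r; apply.
pose L := A1 * ('X%:P * 'X^M * a - 'X^N * b); pose S := 'X^(M.+1) * a * B1.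
have LE s r : s != 0 -> L.[s, r] = s ^+ N * s ^+ M *
    (A1.[s, r] * (r * A0.[s^-1, r / s] - B0.[s^-1, r / s])).
  by move=> s0; rewrite !hrE aE// bE//; ring.
have SE s r : s != 0 -> S.[s, r] = s ^+ N * s ^+ M *
    (s * A0.[s^-1, r / s] * B1.[s, r]).
  by move=> s0; rewrite !hrE aE// exprS; ring.
clearbody L S.
have LS : L - S = 0.
  have msurj (x y : C) : x != 0 -> y != 0 -> exists u t,
      t != 0 /\ ('X : F2).[u, t] / t = x /\ (1%:P%:P : F2).[u, t] / t = y.
    move=> x0 y0; exists (x / y), y^-1; rewrite !hrE invrK invr_eq0 mul1r.
    by rewrite divfK.
  case/orP: PQ0 => [P0|Q0].
    apply: (density P0 msurj) => s r s0 r0; rewrite !hrE mul1r => Pn.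
    by rewrite LE// SE// rel ?subrr// Pn.
  apply: (density Q0 msurj) => s r s0 r0; rewrite !hrE mul1r => Qn.
  by rewrite LE// SE// rel ?subrr// Qn orbT.
move=> s r s0; apply: (mulfI (mulf_neq0 (expf_neq0 N s0) (expf_neq0 M s0))).
by rewrite -LE// -SE//; apply/eqP; rewrite -subr_eq0 -!hornerN -!hornerD LS !hrE.
Qed.

End Collinearity.

Section Generators.

Variable R : realType.
Local Notation C := (CC R).
Variables (v : polyvf R) (v_neq0 : v <> (0, 0)).

Lemma vf_components_neq0 : (v.1 != 0) || (v.2 != 0).
Proof.
case: v v_neq0 => P Q /= PQ0; rewrite -negb_and; apply/negP.
by move=> /andP[/eqP P0 /eqP Q0]; apply: PQ0; rewrite P0 Q0.
Qed.

Lemma generates_coprime2 k w : generates v k w -> coprime2 w.1 w.2.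
Proof. by move=> [/isolated_zeros_coprime2]. Qed.

Lemma generates_collinear k w w' : k = k0 \/ k = k1 ->
  generates v k w -> generates v k w' -> w.1 * w'.2 = w'.1 * w.2.
Proof.
move=> [->|->] gw gw'.
  apply: (@same_chart_density _ v.1 v.2 1%:P%:P 'X); first exact: vf_components_neq0.
    move=> x y x0 y0; exists (y / x), x^-1; rewrite !hrE invrK invr_eq0 mul1r.
    by rewrite divfK.
  move=> u t t0; rewrite !hrE mul1r => vn.
  apply: (same_chart_cross (u := u) t0).
  have G := generates0 u gw t0; have G' := generates0 u gw' t0.
  exact: cross_collinear vn G G'.
apply: (@same_chart_density _ v.1 v.2 'X 1%:P%:P); first exact: vf_components_neq0.
  move=> x y x0 y0; exists (x / y), y^-1; rewrite !hrE invrK invr_eq0 mul1r.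
  by rewrite divfK.
move=> u t t0; rewrite !hrE mul1r => vn.
apply: (same_chart_cross (u := u) t0); symmetry.
exact: cross_collinear vn (generates1 u gw t0) (generates1 u gw' t0).
Qed.

Lemma generates_proportional k w w' : k = k0 \/ k = k1 ->
  generates v k w -> generates v k w' ->
  exists2 c : C, c != 0 & w'.1 = c%:P%:P * w.1 /\ w'.2 = c%:P%:P * w.2.
Proof.
move=> k01 gw gw'; apply: coprime2_proportional.
- exact: generates_coprime2 gw.
- exact: generates_coprime2 gw'.
- exact: generates_collinear gw gw'.
Qed.

Lemma generates_rel_charts w0 w1 :
  generates v k0 w0 -> generates v k1 w1 -> rel_charts w0.1 w0.2 w1.1 w1.2.
Proof.
move=> g0 g1; apply: (@two_charts_density _ v.1 v.2 w0.1 w0.2 w1.1 w1.2).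
  exact: vf_components_neq0.
move=> s r s0 r0 vn; apply: (two_charts_cross s0 r0).
have rs0 : r / s != 0 by rewrite mulf_neq0 ?invr_eq0.
have e1 : (r / s)^-1 = s / r by rewrite invf_div.
have e2 : s^-1 * (s / r) = r^-1 by rewrite mulrA mulVf ?mul1r.
have vE (p : {poly {poly C}}) : p.[(r / s)^-1, s^-1 / (r / s)] = p.[s / r, r^-1].
  by rewrite e1 e2.
have G0 := generates0 s^-1 g0 rs0; rewrite !vE in G0.
exact: cross_collinear vn G0 (generates1 s g1 r0).
Qed.

End Generators.

(** * Points of the line at infinity *)

Section PointsAtInfinity.

Variable R : realType.
Local Notation C := (CC R).

Lemma P2_eq (p p' : P2 R) : sval p = sval p' -> p = p'.
Proof. by move=> pp'; apply: val_inj. Qed.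

Lemma pt_eq_homog k q k' q' : @pt R k q = pt k' q' ->
  exists l, forall j, homog k q ord0 j = l * homog k' q' ord0 j.
Proof.
move=> /(congr1 sval)/= E; have : homog k q \in <[homog k' q']>%VS.
  by rewrite -E memv_line.
by move=> /vlineP[l ->]; exists l => j; rewrite mxE.
Qed.

Lemma Linf_pt k q : Linf (@pt R k q) <-> homog k q ord0 ord_max = 0.
Proof.
split=> [|h X]; first by apply; rewrite memv_line.
by move=> /vlineP[l ->]; rewrite mxE h mulr0.
Qed.

Lemma homog_last k (q : C * C) : k = k0 \/ k = k1 ->
  homog k q ord0 ord_max = q.2.
Proof. by move=> [->|->]; rewrite ?homog0E ?homog1E mxE. Qed.

Lemma Linf_cases (p : P2 R) : Linf p ->
  (exists u, p = pt k0 (u, 0)) \/ p = pt k1 (0, 0).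
Proof.
case: p => U Ud Lp; have U0 : U != 0%VS.
  by apply/eqP => U0; move: (Ud); rewrite {1}U0 dimv0.
pose X := vpick U; have XU : X \in U by exact: memv_pick.
have X0 : X != 0 by rewrite vpick0.
have UE : <[X]>%VS = U.
  by apply/eqP; rewrite eqEdim -memvE XU dim_vline X0 (eqP Ud).
have X2 : X ord0 k2 = 0 by exact: Lp.
have X0E l Y : l != 0 -> l *: X = Y -> U = <[Y]>%VS.
  move=> l0 <-; rewrite -UE; apply/eqP; rewrite eqEsubv -!memvE.
  rewrite [X in _ && X]memvZ ?memv_line// andbT.
  by apply/vlineP; exists l^-1; rewrite scalerA mulVf// scale1r.
have [x0|x0] := eqVneq (X ord0 k0) 0.
  have x1 : X ord0 k1 != 0.
    apply: contra_neq X0 => x1; apply/rowP => j; rewrite mxE.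
    by have [->|->|->] := chart_cases j.
  right; apply: P2_eq => /=; apply: (X0E (X ord0 k1)^-1); first by rewrite invr_eq0.
  apply/rowP => j; rewrite homog1E !mxE.
  have [->|->|->] := chart_cases j; rewrite ?x0 ?X2 ?mulr0//.
  by rewrite inordK// mulVf.
left; exists (X ord0 k1 / X ord0 k0); apply: P2_eq => /=.
apply: (X0E (X ord0 k0)^-1); first by rewrite invr_eq0.
apply/rowP => j; rewrite homog0E !mxE.
have [->|->|->] := chart_cases j; rewrite ?X2 ?mulr0 ?mulVf//.
by rewrite inordK// mulrC.
Qed.

Lemma charts_at_finite k q (u : C) : pt k q = pt k0 (u, 0) ->
  (k = k0 /\ q = (u, 0)) \/ [/\ k = k1, u != 0 & q = (u^-1, 0)].
Proof.
move=> /pt_eq_homog[l E]; have := (E k0, E k1, E k2).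
have [->|->|->] := chart_cases k; rewrite [homog k0 (u, 0)]homog0E.
- rewrite homog0E !mxE /= !inordK//= mulr0 mulr1 => -[[<- q1] q2].
  by left; split=> //; case: q q1 q2 {E} => x y /= -> ->; rewrite mul1r.
- rewrite homog1E !mxE /= !inordK//= mulr0 mulr1 => -[[q1 lu] q2]; right.
  have u0 : u != 0.
    by apply/eqP => u0; apply: (elimN eqP (oner_neq0 C)); rewrite lu u0 mulr0.
  split=> //; case: q q1 q2 {E} => x y /= -> ->; congr pair.
  by apply: (mulIf u0); rewrite mulVf.
- by rewrite homog2E !mxE /= !inordK//= mulr0 => -[_ /(elimN eqP (oner_neq0 C))].
Qed.

Lemma charts_at_vertical k q : @pt R k q = pt k1 (0, 0) -> k = k1 /\ q = (0, 0).
Proof.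
move=> /pt_eq_homog[l E]; have := (E k0, E k1, E k2).
have [->|->|->] := chart_cases k; rewrite [homog k1 (0, 0)]homog1E.
- by rewrite homog0E !mxE /= !inordK//= mulr0 => -[[/(elimN eqP (oner_neq0 C))]].
- rewrite homog1E !mxE /= !inordK//= mulr0 => -[[q1 _] q2].
  by split=> //; case: q q1 q2 {E} => x y /= -> ->.
- by rewrite homog2E !mxE /= !inordK//= mulr0 => -[_ /(elimN eqP (oner_neq0 C))].
Qed.

End PointsAtInfinity.

(** * The Camacho-Sad index at a non-degenerate point *)

Section LocalModels.

Variable R : realType.
Local Notation C := (CC R).
Variable v : polyvf R.
Implicit Types (w : polyvf R) (a b : {poly C}) (u : C) (p : P2 R).

(** The first component of [w] on the line at infinity. Its derivative at a zero
    is the eigenvalue in the direction of the line. *)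
Definition tangential w : {poly C} := slice 0 w.1.

(** The function [b] on the line when [w = a d/ds + t b d/dt]; at a zero of [w]
    it is the eigenvalue in the normal direction. *)
Definition normal w : {poly C} := slice 0 (divy w.2).

(** Every generator around [p] vanishes at [p] exactly when [a] vanishes at [u],
    and then its eigenvalues at [p] are [a^`().[u]] and [b.[u]] up to a common
    non-zero factor. *)
Definition local_model p a b u :=
  (exists k q w, generates_at v p k q w) /\
  forall k q w, generates_at v p k q w ->
  [/\ k = k0 \/ k = k1, q.2 = 0, slice 0 w.2 = 0,
      root (tangential w) q.1 = root a u
    & root a u -> exists2 d : C, d != 0 &
       (tangential w)^`().[q.1] = d * a^`().[u] /\
       (normal w).[q.1] = d * b.[u]].

Lemma Sing_local_model p a b u :
  local_model p a b u -> (Sing v p <-> root a u).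
Proof.
move=> [[k [q [w g]]] loc]; split.
  move=> [k' [q' [w' [g']]]]; have [_ q2 _ <- _] := loc _ _ _ g'.
  case: q' q2 {g'} => x y /= -> /vf_eq0[A0 _].
  by apply/rootP; rewrite horner_slice.
have [_ q2 B0 <- _] := loc _ _ _ g; case: q q2 g => x y /= -> g /rootP A0.
exists k, (x, 0), w; split=> //; apply/vf_eq0.
by rewrite -!horner_slice B0 horner0.
Qed.

(** The differential maps the vector [(1, 0)], tangent to the invariant line, to
    its multiple by a non-zero multiple of [a^`().[u]]. *)
Lemma nondegenerate_local_model p a b u : local_model p a b u ->
  nondegenerate_at v p -> root a u -> a^`().[u] != 0.
Proof.
move=> [_ loc] [k [q [w [g _ [f fK _]]]]] ra.
have [_ q2 B0 _ /(_ ra)[d d0 [aE _]]] := loc _ _ _ g.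
suff : (tangential w)^`().[q.1] != 0 by rewrite aE mulf_eq0 negb_or => /andP[].
apply/eqP => a'0.
have [e1 h1] := is_diff_bipoly w.1 q; have [e2 h2] := is_diff_bipoly w.2 q.
have dE := @diff_val _ _ _ _ _ _ _ (is_diff_pair h1 h2).
have deriv_slice (A : {poly {poly C}}) x : A^`().[x, 0] = (slice 0 A)^`().[x].
  by rewrite -horner_slice /slice deriv_map.
have : ((1, 0) : C * C) = (0, 0).
  rewrite -[LHS]fK -[RHS]fK; congr f.
  rewrite /vf dE /= !mul0r !mul1r !addr0 q2 !deriv_slice B0 deriv0 horner0.
  by rewrite a'0.
by move=> /(congr1 fst)/= /(elimN eqP (oner_neq0 C)).
Qed.

Definition shift (c : C) (A : {poly {poly C}}) := A \Po ('X + c%:P%:P).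

Lemma horner_shift c A x y : (shift c A).[x, y] = A.[c + x, y].
Proof. by rewrite /shift horner_comp hornerD hornerX hornerC -polyCD addrC. Qed.


Lemma residue_shift a b c : root a c -> a^`().[c] != 0 ->
  is_residue0 (fun s => b.[c + s] / a.[c + s]) (b.[c] / a^`().[c]).
Proof.
move=> ra a'c; pose sh (p : {poly C}) := p \Po ('X + c%:P).
have shE (r : {poly C}) (x : C) : (sh r).[x] = r.[c + x].
  by rewrite /sh horner_comp hornerD hornerX hornerC addrC.
have sh' (r : {poly C}) (x : C) : (sh r)^`().[x] = r^`().[c + x].
  by rewrite /sh deriv_comp derivD derivX derivC addr0 mulr1 -shE.
have := @residue_simple_pole R (sh a) (sh b).
rewrite sh' shE addr0 /root shE addr0 => /(_ ra a'c).
by under eq_fun do rewrite !shE.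
Qed.

(** In each admissible chart the form is [b / a ds] with a simple pole at the
    point, so its residue is the ratio of the eigenvalues; the local model makes
    it independent of the chart and of the generator. *)
Lemma is_CS_local_model p a b u c : local_model p a b u ->
  root a u -> a^`().[u] != 0 -> is_CS v p c <-> c = b.[u] / a^`().[u].
Proof.
move=> [[k [q [w g]]] loc] ra a'u.
have ratio k' q' w' : generates_at v p k' q' w' ->
    [/\ root (tangential w') q'.1, (tangential w')^`().[q'.1] != 0 &
     (normal w').[q'.1] / (tangential w')^`().[q'.1] = b.[u] / a^`().[u]].
  move=> g'; have [_ _ _ rE /(_ ra)[d d0 [aE bE]]] := loc _ _ _ g'.
  rewrite rE ra aE bE mulf_neq0//; split=> //.
  by rewrite invfM mulrACA mulfV ?mul1r.
split.
  move=> [k' [q' [w' [A [B [g' _ wE res]]]]]].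
  have [ra' a'N0 <-] := ratio _ _ _ g'; have [_ q2 B0 _ _] := loc _ _ _ g'.
  apply: is_residue0_uniq res _.
  have AE s : A.[s, 0] = (tangential w').[q'.1 + s].
    have /(congr1 fst)/= <- := wE s 0.
    by rewrite /tangential horner_slice q2 addr0.
  have BE s : B.[s, 0] = (normal w').[q'.1 + s].
    rewrite /normal horner_slice; congr horner; symmetry.
    apply: (@eq_poly_off _ [:: 0]) => t; rewrite inE => t0; apply: (mulfI t0).
    have /(congr1 snd)/= <- := wE s t.
    by rewrite q2 add0r {2}(divyE B0) hornerM hornerC hornerM hornerX.
  under eq_fun do rewrite AE BE.
  exact: residue_shift.
move=> ->; have [ra' a'N0 <-] := ratio _ _ _ g; have [k01 q2 B0 _ _] := loc _ _ _ g.
exists k, q, w, (shift q.1 w.1), (shift q.1 (divy w.2)); split=> //.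
- by move=> s t; rewrite Linf_pt homog_last//= q2 add0r.
- move=> s t; rewrite /vf /= q2 add0r !horner_shift {1}(divyE B0).
  by rewrite hornerM hornerC hornerM hornerX.
- under eq_fun do rewrite !horner_shift -!horner_slice.
  exact: residue_shift.
Qed.

Lemma CS_local_model p a b u : local_model p a b u ->
  root a u -> a^`().[u] != 0 -> CS v p = b.[u] / a^`().[u].
Proof.
move=> loc ra a'u; have H := is_CS_local_model _ loc ra a'u.
by apply/H; apply: xgetPex; exists (b.[u] / a^`().[u]); apply/H.
Qed.

End LocalModels.

(** * The sum of the indices *)

Lemma mulf_cancel0 (F : idomainType) (c x : F) : c != 0 -> c * x = 0 -> x = 0.
Proof. by move=> c0 /eqP; rewrite mulf_eq0 (negPf c0) => /eqP. Qed.

Section InvariantLine.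

Variable R : realType.
Local Notation C := (CC R).
Variables (v : polyvf R) (v_neq0 : v <> (0, 0)) (L_invariant : Linf_invariant v).

Lemma Linf_finite (u : C) : Linf (pt k0 (u, 0)).
Proof. by apply/Linf_pt; rewrite homog_last//; left. Qed.

Lemma Linf_vertical : Linf (pt k1 ((0 : C), (0 : C))).
Proof. by apply/Linf_pt; rewrite homog_last//; right. Qed.

(** The points [1 : 0 : 0] and [0 : 1 : 0] lie in a single one of the charts that
    meet the line, so invariance at these points yields a generator in each. *)
Lemma exists_generators : exists w0 w1, generates v k0 w0 /\ generates v k1 w1.
Proof.
have [k [q [w0 [[/charts_at_finite E g0] _]]]] := L_invariant (@Linf_finite 0).
have [k' [q' [w1 [[/charts_at_vertical[k'E _] g1] _]]]] := L_invariant (@Linf_vertical).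
exists w0, w1; rewrite -k'E; split=> //.
by case: E => [[<-]//|[_]]; rewrite eqxx.
Qed.

Lemma invariant_component k q w : k = k0 \/ k = k1 ->
  'd (fun q' : C * C => homog k q' ord0 ord_max : C) q (vf w q) = 0 ->
  w.2.[q.1, q.2] = 0.
Proof.
move=> k01; have -> : (fun q' : C * C => homog k q' ord0 ord_max : C) = snd.
  by apply/funext => q'; rewrite homog_last.
by rewrite (@diff_val _ _ _ _ _ _ _ (is_diff_snd q)).
Qed.

Lemma proportional_eigenvalues (c : C) (w w' : polyvf R) (x : C) : c != 0 ->
  slice 0 w.2 = 0 -> w'.1 = c%:P%:P * w.1 -> w'.2 = c%:P%:P * w.2 ->
  [/\ slice 0 w'.2 = 0, root (tangential w') x = root (tangential w) x &
     (tangential w')^`().[x] = c * (tangential w)^`().[x] /\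
     (normal w').[x] = c * (normal w).[x]].
Proof.
move=> c0 w20 w1E w2E.
have slC : slice 0 (c%:P%:P : {poly {poly C}}) = c%:P.
  by rewrite /slice map_polyC /= /horner_eval hornerC.
have tE : tangential w' = c%:P * tangential w by rewrite /tangential w1E sliceM slC.
have nE : normal w' = c%:P * normal w.
  rewrite /normal (@divyK _ w'.2 (c%:P%:P * divy w.2)) ?sliceM ?slC//.
  by rewrite w2E {1}(divyE w20) mulrCA.
split; first by rewrite w2E sliceM w20 mulr0.
  by rewrite tE mul_polyC rootZ.
by rewrite tE nE mul_polyC derivZ hornerZ mul_polyC hornerZ.
Qed.

Section Generators.

Variables (w0 w1 : polyvf R) (g0 : generates v k0 w0) (g1 : generates v k1 w1).

Lemma generators_axis : exists n k (c : C), [/\ c != 0,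
   forall x, x != 0 -> x ^+ n * (- x ^+ 2 * (tangential w0).[x^-1]) =
     c * x ^+ k * (tangential w1).[x],
   forall x, x != 0 -> x ^+ n * (x * (slice 0 w0.2).[x^-1]) =
     c * x ^+ k * (slice 0 w1.2).[x]
  & slice 0 w0.2 = 0 -> slice 0 w1.2 = 0 -> forall x, x != 0 ->
     x ^+ n * ((normal w0).[x^-1] - x * (tangential w0).[x^-1]) =
     c * x ^+ k * (normal w1).[x]].
Proof.
have rel := generates_rel_charts v_neq0 g0 g1.
exact: rel_charts_axis (generates_coprime2 g0) (generates_coprime2 g1) rel.
Qed.

(** Invariance at a point may be witnessed in the other chart; [generators_axis]
    carries it back to the first one. *)
Lemma axis_invariant0 : slice 0 w0.2 = 0.
Proof.
apply: poly_fun0 => u.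
have [k [q [w [[/charts_at_finite E g]]]]] := L_invariant (@Linf_finite u).
case: E => [[kE qE]|[kE u0 qE]]; subst k q.
  move=> /(invariant_component (or_introl erefl)) /=.
  have [c c0 [_ ->]] := generates_proportional v_neq0 (or_introl erefl) g0 g.
  by rewrite !hornerM !hornerC -horner_slice => /(mulf_cancel0 c0).
move=> /(invariant_component (or_intror erefl)) /=.
have [c c0 [_ ->]] := generates_proportional v_neq0 (or_intror erefl) g1 g.
rewrite !hornerM !hornerC -horner_slice => /(mulf_cancel0 c0) B1.
have [n [m [d [d0 _ rel _]]]] := generators_axis.
have ui : u^-1 != 0 by rewrite invr_eq0.
have := rel _ ui; rewrite B1 mulr0 invrK.
by move=> /(mulf_cancel0 (expf_neq0 n ui))/(mulf_cancel0 ui).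
Qed.

Lemma axis_invariant1 : slice 0 w1.2 = 0.
Proof.
apply: (@eq_poly_off _ [:: 0]) => x; rewrite inE horner0 => x0.
have [n [m [d [d0 _ rel _]]]] := generators_axis.
have := rel _ x0; rewrite axis_invariant0 horner0 !mulr0.
by move=> /esym/(mulf_cancel0 (mulf_neq0 d0 (expf_neq0 m x0))).
Qed.

(** Generators of the first chart are proportional to [w0]; those of the second
    are proportional to [w1], whose eigenvalues are compared with those of [w0]
    by [eigenvalues_transfer]. *)
Lemma local_model_finite (u : C) :
  local_model v (pt k0 (u, 0)) (tangential w0) (normal w0) u.
Proof.
split; first by exists k0, (u, 0), w0.
move=> k q w [/charts_at_finite E g].
case: E => [[kE qE]|[kE u0 qE]]; subst k q.
  have [c c0 [E1 E2]] := generates_proportional v_neq0 (or_introl erefl) g0 g.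
  have [B rE Eig] := proportional_eigenvalues u c0 axis_invariant0 E1 E2.
  by split=> //; [left|move=> _; exists c].
have [c c0 [E1 E2]] := generates_proportional v_neq0 (or_intror erefl) g1 g.
have [B rE [dE nE]] := proportional_eigenvalues u^-1 c0 axis_invariant1 E1 E2.
have [n [m [d [d0 relt _ /(_ axis_invariant0 axis_invariant1) reln]]]] := generators_axis.
have [rE' Eig] := eigenvalues_transfer d0 u0 relt reln.
split=> //; [by right|by rewrite rE|move=> /Eig[e e0 [De Ne]]].
by exists (c * e); [rewrite mulf_neq0|rewrite /= dE nE De Ne !mulrA].
Qed.

Lemma local_model_vertical :
  local_model v (pt k1 (0, 0)) (tangential w1) (normal w1) 0.
Proof.
split; first by exists k1, (0, 0), w1.
move=> k q w [/charts_at_vertical[kE qE] g]; subst k q.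
have [c c0 [E1 E2]] := generates_proportional v_neq0 (or_intror erefl) g1 g.
have [B rE Eig] := proportional_eigenvalues 0 c0 axis_invariant1 E1 E2.
by split=> //; [right|move=> _; exists c].
Qed.

Hypothesis L_nondegenerate : forall p : P2 R,
  (@Linf R `&` Sing v) p -> nondegenerate_at v p.

Lemma simple_zero_finite (u : C) :
  root (tangential w0) u -> (tangential w0)^`().[u] != 0.
Proof.
move=> ru; have loc := local_model_finite u.
apply: (nondegenerate_local_model loc) => //; apply: L_nondegenerate.
by split; [exact: Linf_finite|apply/(Sing_local_model loc)].
Qed.

Lemma simple_zero_vertical :
  root (tangential w1) 0 -> (tangential w1)^`().[0] != 0.
Proof.
move=> r0; have loc := local_model_vertical.
apply: (nondegenerate_local_model loc) => //; apply: L_nondegenerate.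
by split; [exact: Linf_vertical|apply/(Sing_local_model loc)].
Qed.

Lemma sum_CS_generators : \sum_(p \in @Linf R `&` Sing v) CS v p = 1.
Proof.
have [rs rsE] := closed_field_poly_normal (tangential w0).
have a0 : tangential w0 != 0.
  apply/eqP => a0; have := @simple_zero_finite 0.
  by rewrite a0 root0 deriv0 horner0 eqxx => /(_ isT).
have l0 : lead_coef (tangential w0) != 0 by rewrite lead_coef_eq0.
have rootE x : root (tangential w0) x = (x \in rs).
  by rewrite rsE rootZ// root_prod_XsubC.
have urs : uniq rs.
  apply: uniq_simple_roots => x; rewrite -rootE => /simple_zero_finite.
  by rewrite {1}rsE derivZ hornerZ mulf_eq0 negb_or => /andP[].
pose pts := [seq pt k0 (x, 0) | x <- rs] ++
  (if root (tangential w1) 0 then [:: pt k1 (0, 0)] else [::]).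
have ptsE : @Linf R `&` Sing v = [set` pts].
  apply/seteqP; split=> p /=.
    move=> [/Linf_cases[[u ->]|->]].
      move=> /(Sing_local_model (local_model_finite u)); rewrite rootE => urs'.
      by rewrite mem_cat; apply/orP; left; apply/mapP; exists u.
    move=> /(Sing_local_model local_model_vertical) r0.
    by rewrite mem_cat r0 mem_head orbT.
  rewrite mem_cat => /orP[/mapP[u urs' ->]|].
    split; first exact: Linf_finite.
    by apply/(Sing_local_model (local_model_finite u)); rewrite rootE.
  case: ifP => // r0; rewrite inE => /eqP ->.
  split; first exact: Linf_vertical.
  exact/(Sing_local_model local_model_vertical).
have upts : uniq pts.
  rewrite cat_uniq map_inj_uniq ?urs /=; last first.
    move=> x y /charts_at_finite[[_ /(congr1 fst)]//|[/(congr1 val)]].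
    by rewrite /= inordK.
  apply/andP; split; last by case: ifP.
  have vertical : pt k1 ((0 : C), (0 : C)) \notin [seq pt k0 (x, (0 : C)) | x <- rs].
    apply/mapP => -[x _ /esym/charts_at_vertical[]].
    by move=> /(congr1 val); rewrite /= inordK.
  by apply/hasPn => p; case: ifP => // _; rewrite inE => /eqP ->.
rewrite ptsE -fsbig_seq// /pts big_cat big_map /=.
have -> : \sum_(x <- rs) CS v (pt k0 (x, 0)) =
    \sum_(x <- rs) (normal w0).[x] / (tangential w0)^`().[x].
  apply: eq_big_seq => x; rewrite -rootE => rx.
  exact: CS_local_model (local_model_finite x) rx (simple_zero_finite rx).
have -> : \sum_(p <- if root (tangential w1) 0 then [:: pt k1 (0, 0)] else [::])
     CS v p = if root (tangential w1) 0 then (normal w1).[0] / (tangential w1)^`().[0]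
   else 0.
  case: ifP => [r0|_]; last by rewrite big_nil.
  rewrite big_seq1.
  exact: CS_local_model local_model_vertical r0 (simple_zero_vertical r0).
have [n [m [d [d0 relt _ /(_ axis_invariant0 axis_invariant1) reln]]]] := generators_axis.
exact: sum_residues_P1 d0 relt reln simple_zero_finite simple_zero_vertical rsE urs.
Qed.

End Generators.

End InvariantLine.

Theorem mainTheorem5 (R : realType) (v : polyvf R) (v_neq0 : v <> (0, 0))
    (L_invariant : Linf_invariant v)
    (L_nondegenerate : forall p : P2 R,
        (@Linf R `&` Sing v) p -> nondegenerate_at v p) :
  \sum_(p \in @Linf R `&` Sing v) CS v p = 1.
Proof.
have [w0 [w1 [g0 g1]]] := exists_generators L_invariant.
exact: (sum_CS_generators v_neq0 L_invariant g0 g1 L_nondegenerate).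
Qed.
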